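(* Let $G$ be any $st$-graph that is not an $st$-path and has at least three vertices. Then there exists a constant $C<\infty$ (depending on $G$ but not on $n$) such that $c_1(\mathrm{TC}(G^{\oslash n}))\ge C^{-1}\log|V(G^{\oslash n})|$ for every $n\ge 0$, where $V(G^{\oslash n})$ carries the metric $d_{G^{\oslash n}}$.
   Context: An $st$-graph is a finite directed graph $G$ (no loops; the underlying undirected graph is used for paths and metric) with a set $E(G)$ of directed edges $(u,v)$ ($u$ initial, $v$ terminal), two distinct distinguished vertices $s_G$ (source) and $t_G$ (sink), a positive length $d_G(e)$ for each edge, and a thickness function $th_G:E(G)\to(0,1]$, such that: $d_G$ denotes the shortest-path metric on $V(G)$ for these edge lengths, and each edge's length equals the $d_G$-distance between its endpoints; (a) $d_G(s_G,t_G)=1$; (b) every directed path is a geodesic for $d_G$; (c) there is a finite family $\{\gamma_i\}_{i\in I}$ of (not necessarily distinct) directed edge paths from $s_G$ to $t_G$ with $th_G(e)=|\{i\in I:e\in\gamma_i\}|/|I|$ for all $e\in E(G)$. An $st$-path is an $st$-graph consisting of a single directed path from $s$ to $t$ (all thicknesses 1). The trivial $st$-path has vertices $s,t$ and one edge $(s,t)$ of length 1 and thickness 1. Edge replacement: for $st$-graphs $G,H$ and $e=(u,v)\in E(G)$, $G\cup_e H$ is obtained from the disjoint union of $G$ and $H$ by identifying $u$ with $s_H$ and $v$ with $t_H$ and deleting $e$; each copied edge $e'$ of $H$ (denoted $e\oslash e'$) gets length $d_G(e)d_H(e')$ and thickness $th_G(e)th_H(e')$, other edges of $G$ keep their length and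 thickness, the metric is the resulting shortest-path metric, and $s_{G\cup_eH}=s_G$, $t_{G\cup_eH}=t_G$. The slash product $G\oslash H$ is obtained by performing this replacement for every edge of $G$. Slash powers: $G^{\oslash 0}$ is the trivial $st$-path and $G^{\oslash(n+1)}=G^{\oslash n}\oslash G$. For a finite metric space $(X,d)$, $\mathrm{TC}(X)$ is the space of signed measures on $X$ of total mass $0$ with norm $\|\mu\|_{\mathrm{TC}}=\inf\sum a_i d(x_i,y_i)$ over representations $\mu=\sum a_i(\delta_{x_i}-\delta_{y_i})$, $a_i\ge0$. For a metric space $Y$, $c_1(Y)$ is the infimal $D\ge1$ for which there is a map $F$ into some $L_1$-space with $\rho(x,y)\le\|F(x)-F(y)\|\le D\rho(x,y)$. *)

(* Defs.v *)
From HB Require Import structures.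
From mathcomp Require Import all_boot all_order all_algebra.
From mathcomp Require Import all_classical all_reals all_analysis.
Unset Printing Implicit Defensive.
Import Order.TTheory GRing.Theory Num.Theory.
Local Open Scope classical_set_scope.
Local Open Scope ring_scope.

(** Raw data of a (candidate) st-graph: a finite vertex type, a directed
    adjacency relation (the edge set E(G) is {(u,v) | adj u v}), source,
    sink, edge lengths and thicknesses (only meaningful on edges). *)
Record stgraph (R : realType) := STGraph {
  sV : finType;
  adj : rel sV;
  s_ : sV;
  t_ : sV;
  len : sV -> sV -> R;
  th : sV -> sV -> R }.
Arguments sV {R} s.
Arguments adj {R} s _ _.
Arguments s_ {R} s.
Arguments t_ {R} s.
Arguments len {R} s _ _.
Arguments th {R} s _ _.

Section Defs.
Variable R : realType.

Definition uadj (G : stgraph R) : rel (sV G) := fun x y => adj G x y || adj G y x.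
Definition ulen (G : stgraph R) (x y : sV G) : R :=
  if adj G x y then len G x y else len G y x.

Definition walk_len (G : stgraph R) (x : sV G) (p : seq (sV G)) : R :=
  \sum_(q <- zip (x :: p) p) ulen G q.1 q.2.

Definition dist (G : stgraph R) (x y : sV G) : R :=
  inf [set l | exists p : seq (sV G),
        [/\ path (uadj G) x p, last x p = y & l = walk_len G x p]].

Definition dpath (G : stgraph R) (x : sV G) (p : seq (sV G)) : bool :=
  path (adj G) x p.
Definition on_path (G : stgraph R) (x : sV G) (p : seq (sV G)) (u v : sV G) : bool :=
  (u, v) \in zip (x :: p) p.

Definition is_stgraph (G : stgraph R) : Prop :=
  (forall u, ~~ adj G u u) /\
  s_ G != t_ G /\
  [/\
      (forall x y : sV G, exists p,                                (* connected: d_G is a metric *)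
          path (uadj G) x p /\ last x p = y),
      (forall u v, adj G u v -> 0 < len G u v /\ len G u v = dist G u v),
      dist G (s_ G) (t_ G) = 1,
      (forall x p, dpath G x p -> walk_len G x p = dist G x (last x p))
    & (forall u v, adj G u v -> 0 < th G u v <= 1) /\
      exists gam : seq (seq (sV G)),
        [/\ (0 < size gam)%N,
            (forall p, p \in gam -> dpath G (s_ G) p /\ last (s_ G) p = t_ G)
          & forall u v, adj G u v ->
              th G u v = (count (fun p => on_path G (s_ G) p u v) gam)%:R / (size gam)%:R]].

Definition is_stpath (G : stgraph R) : Prop :=
  exists p : seq (sV G),
    [/\ uniq (s_ G :: p), last (s_ G) p = t_ G,
        (forall x, x \in s_ G :: p),
        (forall u v, adj G u v = ((u, v) \in zip (s_ G :: p) p))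
      & (forall u v, adj G u v -> th G u v = 1)].

Definition trivial_st : stgraph R :=
  @STGraph R bool (fun x y => ~~ x && y) false true (fun _ _ => 1) (fun _ _ => 1).

Section Slash.
Variables G H : stgraph R.

Definition sl_pre : finType := (sV G + (sV G * sV G * sV H))%type.
Definition sl_valid (x : sl_pre) : bool :=
  match x with
  | inl _ => true
  | inr (u, v, w) => [&& adj G u v, w != s_ H & w != t_ H]
  end.
Definition sl_V : finType := {x : sl_pre | sl_valid x}.

(** the copy of vertex w of H inside the copy of H replacing edge (u,v) *)
Definition sl_emb (u v : sV G) (w : sV H) : sl_pre :=
  if w == s_ H then inl u else if w == t_ H then inl v else inr (u, v, w).

Definition sl_edge_of (x y : sl_V) (q : sV G * sV G * sV H * sV H) : bool :=
  let: (u, v, a, b) := q in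
  [&& adj G u v, adj H a b, val x == sl_emb u v a & val y == sl_emb u v b].

Definition sl_adj : rel sl_V := fun x y => [exists q, sl_edge_of x y q].

Definition sl_len (x y : sl_V) : R :=
  if [pick q | sl_edge_of x y q] is Some (u, v, a, b)
  then len G u v * len H a b else 0.
Definition sl_th (x y : sl_V) : R :=
  if [pick q | sl_edge_of x y q] is Some (u, v, a, b)
  then th G u v * th H a b else 0.

Definition sl_s : sl_V := exist _ (inl (s_ G)) isT.
Definition sl_t : sl_V := exist _ (inl (t_ G)) isT.

Definition slash : stgraph R := @STGraph R sl_V sl_adj sl_s sl_t sl_len sl_th.
End Slash.

Fixpoint slash_pow (G : stgraph R) (n : nat) : stgraph R :=
  if n is n'.+1 then slash (slash_pow G n') G else trivial_st.

Definition mass0 (X : finType) (mu : {ffun X -> R}) : Prop := \sum_x mu x = 0.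

Definition tcnorm (X : finType) (d : X -> X -> R) (mu : {ffun X -> R}) : R :=
  inf [set c | exists r : seq (R * X * X),
         [/\ forall q, q \in r -> 0 <= q.1.1,
             forall z, mu z = \sum_(q <- r) q.1.1 * ((q.1.2 == z)%:R - (q.2 == z)%:R)
           & c = \sum_(q <- r) q.1.1 * d q.1.2 q.2]].

Definition c1_TC (X : finType) (d : X -> X -> R) : \bar R :=
  ereal_inf [set D%:E | D in [set D : R | 1 <= D /\
    exists (dT : measure_display) (T : measurableType dT)
           (mu : {measure set T -> \bar R}) (F : {ffun X -> R} -> T -> R),
      (forall f, @mass0 X f -> mu.-integrable setT (EFin \o F f)) /\
      (forall f g, @mass0 X f -> @mass0 X g ->
         ((@tcnorm X d (f - g))%:E <= \int[mu]_x (`|F f x - F g x|)%:E)%E /\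
         (\int[mu]_x (`|F f x - F g x|)%:E <= (D * @tcnorm X d (f - g))%:E)%E)]].

End Defs.

Arguments is_stgraph {R} G.
Arguments is_stpath {R} G.
Arguments slash_pow {R} G n.
Arguments slash {R} G H.
Arguments dist {R} G x y.
Arguments c1_TC {R} X d.
Arguments tcnorm {R} X d mu.

(* Main.v *)
Require Import Defs.
From mathcomp Require Import all_boot all_order all_algebra.
From mathcomp Require Import all_classical all_reals all_analysis.
From mathcomp Require Import lra ring.
Import Order.TTheory GRing.Theory Num.Theory.
Local Open Scope ring_scope.

Set Implicit Arguments.
Unset Strict Implicit.

(** Averaging a bi-Lipschitz map [F] into [L_1] over long translates replaces it by difference
    quotients that are additive up to a small error in [L_1] norm, so every inequality
    [sum_k a_k |f(v_k)| <= sum_l b_l |f(w_l)|] that holds for all real functions [f] on the vertices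
    passes to the transportation cost norms with the distortion as constant.

    The linear inequality is of Sobolev type. Stop the edges of the iterated replacement at the
    first level where their thickness drops below [4^-j], and let [X_j] be the sum over stopped
    edges [e] of [+-th(e) (f(mid e) - f(source e))] with independent random signs. The sum over [j]
    of [E|X_j f|] is at most a constant times the thickness-weighted total variation of [f]. By the
    coarea formula [f] may be taken to be the indicator of a cut of total variation [A]: then
    [E|X_j|^2] is at most a constant times [4^-j A], and [X_j = 0] unless [4^-j] is at most a
    constant times [A], so the sum over [j] is geometric. On the other hand each [X_j] is a measure
    of transportation cost bounded below, for all [j] up to a multiple of [n], because an edge
    chosen at random by thickness times length is thin with high probability. *)

(** * Linearization by averaging over translates *)

Lemma subrACA (V : zmodType) (x y z w : V) : x - y - (z - w) = x - z - (y - w).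
Proof. by rewrite !opprD addrACA. Qed.

Lemma archi_mul (R : realType) (x e : R) : 0 < e ->
  exists M : nat, (0 < M)%N /\ x <= e * M%:R.
Proof.
move=> e0; exists (Num.truncn (x / e)).+1; split=> //.
by have := truncnS_gt (x / e); rewrite ltr_pdivrMr// [ltRHS]mulrC => /ltW.
Qed.

Lemma sumr_const_seq (R : pzSemiRingType) (I : Type) (s : seq I) (c : R) :
  \sum_(i <- s) c = c * (size s)%:R.
Proof. by rewrite big_const_seq count_predT iter_addr_0 mulr_natr. Qed.

(* Foelner sets: a shift by a vector of [us] changes averages over [Y] by at most [2K/M]. *)
Lemma folner (R : realType) (L : zmodType) (us : seq L) (M : nat) :
  (0 < M)%N -> exists Y : seq L, (0 < size Y)%N /\
  forall u, u \in us -> forall (E : lmodType R) (q : E -> R),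
    (forall x y, q (x + y) <= q x + q y) -> (forall x, q (- x) = q x) -> q 0 = 0 ->
    forall (g : L -> E) (K : R), (forall z, q (g z) <= K) ->
    q (\sum_(y <- Y) (g (y + u) - g y)) * M%:R <= K * 2 * (size Y)%:R.
Proof.
move=> M0; elim: us => [|u us [Y [Y0 HY]]]; first by exists [:: 0].
(* The old set is thickened by the progression 0, u, ..., (M-1)u. A shift by [u] then telescopes
   along the progression and leaves only its two end terms. *)
exists [seq y + u *+ a | a <- iota 0 M, y <- Y]; split.
  by rewrite size_allpairs size_iota muln_gt0 M0.
move=> u' u'in E q qD qN q0 g K gK.
have qsum (I : Type) (s : seq I) (h : I -> E) : q (\sum_(i <- s) h i) <= \sum_(i <- s) q (h i).
  elim: s => [|i s IH]; first by rewrite !big_nil q0.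
  by rewrite !big_cons (le_trans (qD _ _))// lerD2l.
rewrite big_allpairs_dep /= size_allpairs size_iota natrM.
have [->|u'u] := eqVneq u' u.
  rewrite exchange_big /= mulrCA [X in X <= _]mulrC ler_wpM2l ?ler0n//.
  apply: (@le_trans _ _ (\sum_(y <- Y) K * 2)); last first.
    by rewrite sumr_const_seq.
  apply: le_trans (qsum _ _ _) _; apply: ler_sum => y _.
  have -> : \sum_(i <- iota 0 M) (g (y + u *+ i + u) - g (y + u *+ i)) =
            g (y + u *+ M) - g y.
    rewrite -[M in iota 0 M]subn0 -/(index_iota 0 M).
    rewrite (telescope_sumr_eq (fun i => g (y + u *+ i))) ?mulr0n ?addr0//.
    by move=> i _; rewrite mulrSr addrA.
  by apply: le_trans (qD _ _) _; rewrite qN mulr_natr mulr2n lerD.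
(* For an older shift the inductive bound applies to each translate of [g] by [u *+ i], and the [M]
   translates are added. *)
move: u'in; rewrite inE (negbTE u'u) /= => u'in.
apply: (@le_trans _ _ (\sum_(i <- iota 0 M) K * 2 * (size Y)%:R)); last first.
  by rewrite sumr_const_seq size_iota [leRHS]mulrCA [leLHS]mulrC.
apply: (le_trans (ler_wpM2r _ (qsum _ _ _))); first by rewrite ler0n.
rewrite mulr_suml; apply: ler_sum => i _.
under eq_bigr do rewrite addrAC.
exact: (HY u' u'in E q qD qN q0 (fun y => g (y + u *+ i)) K).
Qed.

Section Linearization.
Variables (R : realType) (L : zmodType) (E : lmodType R) (q : E -> R).
Hypothesis qD : forall x y, q (x + y) <= q x + q y.
Hypothesis qZ : forall (c : R) x, q (c *: x) = `|c| * q x.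
Variable F : L -> E.
Hypothesis Fbnd : forall u, exists K : R, forall z, q (F (z + u) - F z) <= K.

Let qN x : q (- x) = q x. Proof. by rewrite -scaleN1r qZ normrN1 mul1r. Qed.
Let q0 : q 0 = 0. Proof. by rewrite -(scale0r 0) qZ normr0 mul0r. Qed.
Let q_ge0 x : 0 <= q x.
Proof. by have := qD x (- x); rewrite qN subrr q0; lra. Qed.

Let qsubD x y : q (x - y) <= q x + q y.
Proof. by rewrite -(qN y); exact: qD. Qed.

Let qsum (I : Type) (s : seq I) (h : I -> E) :
  q (\sum_(i <- s) h i) <= \sum_(i <- s) q (h i).
Proof.
elim: s => [|i s IH]; first by rewrite !big_nil q0.
by rewrite !big_cons (le_trans (qD _ _))// lerD2l.
Qed.

Lemma uniform_shift_bound (us : seq L) :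
  exists K : R, 0 < K /\ forall u, u \in us -> forall z, q (F (z + u) - F z) <= K.
Proof.
elim: us => [|u us [K [K0 HK]]]; first by exists 1.
have [K' HK'] := Fbnd u; exists (K + `|K'|); split; first by rewrite ltr_pwDl.
move=> v; rewrite inE => /orP[/eqP->|vin] z.
  by rewrite (le_trans (HK' z))// (le_trans (ler_norm _))// lerDr ltW.
by rewrite (le_trans (HK _ vin z))// lerDl.
Qed.

(** [Ft] is the average of [F] over translates by a Foelner set. Averaging preserves every bound on
    increments and moves [F] by a bounded amount. The increment along [dl p] hardly depends on the
    base point, since moving the base point by a partial sum only shifts the averaging set. *)
Lemma smoothing (I : finType) (dl : I -> L) (ls : seq (seq I)) (eta : R) :
  0 < eta -> exists Ft : L -> E,
  [/\ exists K : R, 0 < K /\ forall z, q (Ft z - F z) <= K,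
      forall u K, (forall z, q (F (z + u) - F z) <= K) -> forall z, q (Ft (z + u) - Ft z) <= K
    & forall l, l \in ls -> forall x,
        q (Ft (x + \sum_(p <- l) dl p) - Ft x - \sum_(p <- l) (Ft (x + dl p) - Ft x)) <= eta].
Proof.
move=> eta0.
have [K [K0 HK]] := uniform_shift_bound [seq dl p | p <- enum I].
(* The shifts are the sums over tails of the lists. Each letter costs an error [2K/M], and [M] is
   taken so large that [S] such errors stay below [eta]. *)
pose S := (\sum_(l <- ls) size l)%N.
pose us := [seq \sum_(p <- drop k l) dl p | l <- ls, k <- iota 0 S.+1].
have [M [M0 HM]] := archi_mul (K * 2 * S%:R) eta0.
have [Y [Y0 HY]] := @folner R L us M M0.
have Yn0 : (size Y)%:R != 0 :> R by rewrite pnatr_eq0 -lt0n.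
pose Ft z := (size Y)%:R^-1 *: \sum_(y <- Y) F (z + y).
have Ftavg (g : L -> E) C : (forall z, q (g z) <= C) ->
    q ((size Y)%:R^-1 *: \sum_(y <- Y) g y) <= C.
  move=> gC; rewrite qZ ger0_norm ?invr_ge0// mulrC ler_pdivrMr ?ltr0n//.
  apply: le_trans (qsum _ _) _; apply: le_trans (_ : \sum_(y <- Y) C <= _).
    exact: ler_sum.
  by rewrite sumr_const_seq.
have cstavg (c : E) : c = (size Y)%:R^-1 *: \sum_(y <- Y) c.
  by rewrite big_const_seq count_predT iter_addr_0 -[c *+ _]scaler_nat scalerA mulVf// scale1r.
exists Ft; split.
- have [K' [K'0 HK']] := uniform_shift_bound Y; exists K'; split=> // z.
  rewrite /Ft [X in _ - X]cstavg -scalerBr -sumrB.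
  rewrite qZ ger0_norm ?invr_ge0// mulrC ler_pdivrMr ?ltr0n//.
  apply: le_trans (qsum _ _) _.
  rewrite big_seq; apply: le_trans (_ : \sum_(y <- Y | y \in Y) K' <= _).
    by apply: ler_sum => y yY; apply: HK'.
  by rewrite -big_seq sumr_const_seq.
- move=> u C HC z; rewrite /Ft -scalerBr -sumrB.
  by apply: (Ftavg (fun y => F (z + u + y) - F (z + y))) => y; rewrite addrAC.
move=> l lin x.
have szl : (size l <= S)%N by rewrite /S (big_rem l)//= leq_addr.
have M0' : 0 < M%:R :> R by rewrite ltr0n.
suff H k : (k <= size l)%N ->
    q (Ft (x + \sum_(p <- drop k l) dl p) - Ft x - \sum_(p <- drop k l) (Ft (x + dl p) - Ft x))
      * M%:R <= K * 2 * (size (drop k l))%:R.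
  have := H 0%N isT; rewrite drop0 => Hl; rewrite -(ler_pM2r M0').
  apply: le_trans Hl _; apply: le_trans HM.
  by rewrite ler_wpM2l ?ler_nat// mulr_ge0// ltW.
(* Induction from the empty tail backwards, adding one letter and one Foelner error at a time. *)
elim: {k}(size l - k)%N {-2}k (erefl (size l - k)%N) => [k ek kl|m IH k ek kl].
  have -> : k = size l by apply/eqP; rewrite eqn_leq kl/= -subn_eq0 ek.
  by rewrite drop_size !big_nil addr0 subrr subr0 q0 mul0r mulr0.
have kl' : (k < size l)%N by rewrite -subn_gt0 ek.
have i0 : I by case: (l) kl'.
rewrite (drop_nth i0 kl') !big_cons /=; set p := nth i0 l k.
set s := \sum_(i <- drop k.+1 l) dl i; set f := \sum_(j <- drop k.+1 l) _.
have {IH} := IH k.+1 _ kl'; rewrite -/s -/f subnS ek => /(_ erefl) IH.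
(* Averaging [g] over [Y] gives the increment of [Ft] at [x], and averaging its shift by [s] gives
   the increment at [x + s]. *)
pose g y := F (x + dl p + y) - F (x + y).
have sus : s \in us.
  apply/allpairsP; exists (l, k.+1); split=> //.
  by rewrite mem_iota add0n ltnS (leq_trans kl').
have gK z : q (g z) <= K.
  by rewrite /g addrAC; apply: HK; apply/mapP; exists p; rewrite ?mem_enum.
have := HY s sus E q qD qN q0 g K gK; rewrite sumrB => Hg.
have {Hg} : q (Ft (x + (dl p + s)) - Ft (x + s) - (Ft (x + dl p) - Ft x)) * M%:R <= K * 2.
  have -> : Ft (x + (dl p + s)) - Ft (x + s) - (Ft (x + dl p) - Ft x) =
     (size Y)%:R^-1 *: (\sum_(y <- Y) g (y + s) - \sum_(y <- Y) g y).
    rewrite /Ft -!scalerBr -!sumrB; congr (_ *: _); apply: eq_bigr => y _.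
    by rewrite /g; congr (F _ - F _ - (F _ - F _)); rewrite -?addrA; congr (_ + _);
      rewrite ?[s + y]addrC.
  rewrite qZ ger0_norm ?invr_ge0// -mulrA mulrC ler_pdivrMr ?ltr0n//.
move=> Hp; rewrite -[(size _).+1%:R]natr1 mulrDr mulr1.
apply: le_trans (lerD IH Hp); rewrite -mulrDl ler_wpM2r//.
apply: le_trans _ (qD _ _); rewrite le_eqVlt; apply/orP; left; apply/eqP; congr q.
rewrite opprD [in LHS]addrA [RHS]addrACA.
set A := Ft (x + (dl p + s)); set B := Ft (x + s).
have -> : B - Ft x + (A - B) = A - Ft x by rewrite addrC addrA subrK.
by rewrite [- f + _]addrC [RHS]addrA.
Qed.

(** The lower bound on [F] is used over [m] steps of [v k]: replacing [F] by [Ft] costs [2 * K0]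
    once, whatever [m] is. The long increment telescopes into [m] single steps, whose averages over
    a Foelner set nearly agree. *)
Lemma averaged_lower_bound (Ft : L -> E) (T : finType) (v w : T -> L) (c : T -> R) (eta : R) :
  0 < eta ->
  (exists K : R, 0 < K /\ forall z, q (Ft z - F z) <= K) ->
  (forall u, exists K : R, forall z, q (Ft (z + u) - Ft z) <= K) ->
  (forall k m x, m%:R * c k <= q (F (x + v k *+ m) - F x)) ->
  exists Z : seq L, (0 < size Z)%N /\ forall k,
    (c k - eta) * (size Z)%:R <= \sum_(x <- Z) q (Ft (x + w k + v k) - Ft (x + w k)).
Proof.
move=> eta0 [K0 [K00 HK0]] Ftb Hc.
have [K [Kpos HK]] : exists K : R, 0 < K /\ forall k z, q (Ft (z + v k) - Ft z) <= K.
  have [K HK] := choice (fun k => Ftb (v k)).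
  exists (1 + \sum_k `|K k|); split; first by rewrite ltr_pwDl// sumr_ge0.
  move=> k z; apply: le_trans (HK k z) _; rewrite (bigD1 k)//= addrCA.
  by apply: le_trans (ler_norm _) _; rewrite lerDl addr_ge0// sumr_ge0.
(* The replacement of [F] then costs at most [eta / 2] per step, and each Foelner shift at most
   [eta / 4]. *)
have [m [m0 Hm]] := archi_mul (K0 * 4) eta0.
have [M [M0 HM]] := archi_mul (K * 8) eta0.
have [Z [Z0 HZ]] := @folner R L [seq w k + v k *+ i | k <- enum T, i <- iota 0 m] M M0.
exists Z; split=> // k.
pose g x : R^o := q (Ft (x + v k) - Ft x).
have Zc i : (i < m)%N ->
    `|\sum_(x <- Z) g (x + (w k + v k *+ i)) - \sum_(x <- Z) g x| <= eta / 4 * (size Z)%:R.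
  move=> im; rewrite -sumrB.
  have /HZ /(_ R^o Num.norm) : w k + v k *+ i \in [seq w k + v k *+ i | k <- enum T, i <- iota 0 m].
    by apply/allpairsP; exists (k, i); rewrite mem_enum mem_iota add0n; split.
  move=> /(_ (@ler_normD _ _) (@normrN _ _) (normr0 _) g K).
  have gK z : `|g z| <= K.
    by have := HK k z; rewrite -(ger0_norm (q_ge0 (Ft (z + v k) - Ft z))).
  move=> /(_ gK) H; have M0' : 0 < M%:R :> R by rewrite ltr0n.
  rewrite -(ler_pM2r M0'); apply: le_trans H _.
  have sz0 : 0 <= (size Z)%:R :> R by rewrite ler0n.
  by have := ler_wpM2l sz0 HM; lra.
have m0' : 0 < m%:R :> R by rewrite ltr0n.
rewrite -(ler_pM2l m0').
have step : \sum_(x <- Z) (m%:R * c k - K0 * 2) <=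
    \sum_(x <- Z) \sum_(i <- iota 0 m) g (x + (w k + v k *+ i)).
  apply: ler_sum => x _.
  have tele : Ft (x + w k + v k *+ m) - Ft (x + w k) =
      \sum_(i <- iota 0 m) (Ft (x + (w k + v k *+ i) + v k) - Ft (x + (w k + v k *+ i))).
    rewrite -[m in RHS]subn0 -/(index_iota 0 m).
    rewrite (telescope_sumr_eq (fun i => Ft (x + w k + v k *+ i))) ?mulr0n ?addr0//.
    by move=> i _; rewrite mulrSr !addrA.
  apply: le_trans (qsum _ _); rewrite -tele.
  have := Hc k m (x + w k).
  have := HK0 (x + w k); have := HK0 (x + w k + v k *+ m).
  set a := Ft (x + w k + _); set b := Ft _; set a' := F _; set b' := F _ => h1 h2 h3.
  have : q (a' - b') <= q (a - b) + q (a - a') + q (b - b').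
    rewrite -(qN (a - a')); apply: (le_trans _ (lerD (qD _ _) (lexx _))).
    apply: le_trans (qD _ _); rewrite opprB.
    have -> : a - b + (a' - a) = a' - b by rewrite addrC addrA subrK.
    by rewrite addrA subrK.
  by lra.
rewrite sumr_const_seq exchange_big /= in step.
have step2 : \sum_(i <- iota 0 m) \sum_(x <- Z) g (x + (w k + v k *+ i)) <=
   \sum_(i <- iota 0 m) (\sum_(x <- Z) g (x + w k) + eta / 2 * (size Z)%:R).
  rewrite big_seq [leRHS]big_seq; apply: ler_sum => i.
  rewrite mem_iota add0n /= => im.
  (* Both [w k + v k *+ i] and [w k] are compared with the unshifted average, hence two errors of
     [eta / 4]. *)
  have := Zc i im; have := Zc 0%N m0; rewrite mulr0n addr0 !ler_norml.
  by lra.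
have := le_trans step step2; rewrite sumr_const_seq size_iota mulrC.
have -> : \sum_(x <- Z) g (x + w k) = \sum_(x <- Z) q (Ft (x + w k + v k) - Ft (x + w k)) by [].
have sz0 : 0 <= (size Z)%:R :> R by rewrite ler0n.
by have := ler_wpM2l sz0 Hm; lra.
Qed.

(** The linear inequality is applied to the increments of the averaged map from a base point [x],
    then summed over the base points [x] of a Foelner set. Additivity up to [eta] turns the
    combinations on the left into genuine increments of [Ft]. *)
Lemma linearization (I T J : finType) (dl : I -> L) (a : T -> R) (lp lm : T -> seq I)
    (c : T -> R) (b : J -> R) (s t : J -> I) (U : J -> R) :
  (forall k, 0 <= a k) -> (forall j, 0 <= b j) ->
  (forall k m x, m%:R * c k <=
     q (F (x + (\sum_(p <- lp k) dl p - \sum_(p <- lm k) dl p) *+ m) - F x)) ->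
  (forall j x, q (F (x + (dl (s j) - dl (t j))) - F x) <= U j) ->
  (forall f : I -> E, \sum_k a k * q (\sum_(p <- lp k) f p - \sum_(p <- lm k) f p) <=
     \sum_j b j * q (f (s j) - f (t j))) ->
  \sum_k a k * c k <= \sum_j b j * U j.
Proof.
move=> a0 b0 Hc HU Hlin; apply/ler_addgt0Pr => e e0.
pose A := \sum_k a k.
have A0 : 0 <= A by apply: sumr_ge0.
(* Two errors [eta] come from additivity along [lp k] and [lm k], a third one from the averaged
   lower bound. *)
pose eta := e / (3 * A + 1).
have eta0 : 0 < eta by rewrite divr_gt0//; lra.
have etaA : 3 * A * eta <= e.
  by rewrite /eta mulrCA ger_pMr// ler_pdivrMr; lra.
have [Ft [FtF Fts Fterr]] := smoothing dl ([seq lp k | k <- enum T] ++ [seq lm k | k <- enum T]) eta0.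
have Ftb u : exists K : R, forall z, q (Ft (z + u) - Ft z) <= K.
  by have [K HK] := Fbnd u; exists K; apply: Fts.
pose vp k := \sum_(p <- lp k) dl p; pose vm k := \sum_(p <- lm k) dl p.
(* The base points are displaced by [vm k], so that a step by [vp k - vm k] ends at displacement
   [vp k]. *)
have [Z [Z0 HZ]] := averaged_lower_bound vm eta0 FtF Ftb Hc.
have Z0' : 0 < (size Z)%:R :> R by rewrite ltr0n.
rewrite -(ler_pM2r Z0').
have main x : \sum_k a k * q (Ft (x + vp k) - Ft (x + vm k)) <=
    \sum_j b j * U j + 2 * A * eta.
  pose f p := Ft (x + dl p) - Ft x.
  have h1 : \sum_j b j * q (f (s j) - f (t j)) <= \sum_j b j * U j.
    apply: ler_sum => j _; apply: ler_wpM2l => //.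
    have := Fts _ _ (HU j) (x + dl (t j)).
    by rewrite /f addrA [x + _ + dl (s j)]addrAC addrK opprB addrA subrK.
  apply: le_trans (lerD h1 (lexx _)).
  apply: le_trans (lerD (Hlin f) (lexx _)).
  rewrite /A mulr_sumr mulr_suml -big_split /=; apply: ler_sum => k _.
  have := Fterr (lp k) _ x; rewrite mem_cat map_f ?mem_enum// => /(_ isT).
  have := Fterr (lm k) _ x; rewrite mem_cat orbC map_f ?mem_enum// => /(_ isT).
  rewrite -/(vp k) -/(vm k).
  set P := Ft (x + vp k); set Q := Ft (x + vm k); set G := Ft x.
  rewrite -/G; set SP := \sum_(p <- lp k) _; set SM := \sum_(p <- lm k) _ => hm hp.
  have : q (P - Q) <= q (\sum_(p <- lp k) f p - \sum_(p <- lm k) f p) + (q (P - G - SP) + q (Q - G - SM)).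
    apply: le_trans (lerD (lexx _) (qsubD _ _)).
    apply: le_trans (qD _ _); rewrite le_eqVlt; apply/orP; left; apply/eqP; congr q.
    by rewrite -/SP -/SM subrACA [P - G - _]subrACA subrr subr0 [RHS]addrC subrK.
  move=> h; have {h} : q (P - Q) <= q (SP - SM) + 2 * eta by lra.
  by move=> /(ler_wpM2l (a0 k)); rewrite -/SP -/SM; lra.
have : \sum_(x <- Z) \sum_k a k * q (Ft (x + vp k) - Ft (x + vm k)) <=
    \sum_(x <- Z) (\sum_j b j * U j + 2 * A * eta) by apply: ler_sum.
rewrite sumr_const_seq exchange_big /= => main'.
have : \sum_k a k * ((c k - eta) * (size Z)%:R) <=
    \sum_k \sum_(x <- Z) a k * q (Ft (x + vp k) - Ft (x + vm k)).
  apply: ler_sum => k _; rewrite -mulr_sumr; apply: ler_wpM2l => //.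
  apply: le_trans (HZ k) _; rewrite le_eqVlt; apply/orP; left; apply/eqP.
  by apply: eq_bigr => x _; congr (q (Ft _ - _)); rewrite -addrA [vm k + _]addrC subrK.
move=> /le_trans /(_ main').
have -> : \sum_k a k * ((c k - eta) * (size Z)%:R) =
    (\sum_k a k * c k - A * eta) * (size Z)%:R.
  rewrite /A mulr_suml -sumrB mulr_suml; apply: eq_bigr => k _.
  by rewrite mulrA mulrBr.
rewrite !(ler_pM2r Z0'); lra.
Qed.

End Linearization.

(** * Integrating linear inequalities in [L1] *)

Section L1.
Variables (R : realType) (dT : measure_display) (T : measurableType dT).
Variable mu : {measure set T -> \bar R}.

Notation L1 := (LfunType mu (@lexx _ _ 1%E)).

(** Only a seminorm, since elements of [L1] are functions rather than classes; the averaging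
    argument uses just subadditivity and homogeneity. *)
Definition l1norm (f : L1) : R := \int[mu]_x `|f x|.

Lemma L1_integrable_norm (f : L1) : mu.-integrable setT (EFin \o (fun x => `|f x|)).
Proof. exact/Lfun1_integrable/Lfun_norm/LfunP. Qed.

Lemma l1normD (f g : L1) : l1norm (f + g) <= l1norm f + l1norm g.
Proof.
rewrite /l1norm -RintegralD//; [|exact: L1_integrable_norm..].
apply: le_Rintegral => //; first exact: L1_integrable_norm.
  rewrite (_ : EFin \o _ = (fun x => (`|f x|)%:E + (`|g x|)%:E)%E); last exact/funext.
  by apply: integrableD => //; exact: L1_integrable_norm.
by move=> x _; exact: ler_normD.
Qed.

Lemma l1normZ (c : R) (f : L1) : l1norm (c *: f) = `|c| * l1norm f.
Proof.
rewrite /l1norm -RintegralZl//; last exact: L1_integrable_norm.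
by apply: eq_Rintegral => x _; rewrite -normrM.
Qed.

Lemma L1_sumE (I : Type) (s : seq I) (f : I -> L1) x :
  (\sum_(i <- s) f i) x = \sum_(i <- s) f i x.
Proof. by elim/big_ind2 : _ => // g1 h1 g2 h2 <- <-. Qed.

Lemma l1_Rintegral_sum (K : finType) (a : K -> R) (f : K -> L1) :
  mu.-integrable setT (EFin \o (fun x => \sum_k a k * `|f k x|)) /\
  \int[mu]_x (\sum_k a k * `|f k x|) = \sum_k a k * l1norm (f k).
Proof.
elim: (index_enum K) => [|k s [IHi IHe]].
  rewrite big_nil (_ : EFin \o _ = cst 0%E); last first.
    by apply/funext => x /=; rewrite big_nil.
  split; first exact: integrable0.
  by under eq_Rintegral do rewrite big_nil; rewrite Rintegral_cst// mul0r.
have ik : mu.-integrable setT (EFin \o (fun x => a k * `|f k x|)).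
  rewrite (_ : EFin \o _ = (fun x => (a k)%:E * (`|f k x|)%:E)%E); last exact/funext.
  by apply: integrableZl => //; exact: L1_integrable_norm.
split.
  rewrite (_ : EFin \o _ = (fun x => (a k * `|f k x|)%:E +
     (\sum_(k <- s) a k * `|f k x|)%:E)%E); last first.
    by apply/funext => x /=; rewrite big_cons EFinD.
  exact: integrableD.
under eq_Rintegral do rewrite big_cons.
by rewrite RintegralD// IHe big_cons RintegralZl//; exact: L1_integrable_norm.
Qed.

Lemma l1_linear_ineq (I K J : finType) (a : K -> R) (lp lm : K -> seq I)
    (b : J -> R) (s t : J -> I) :
  (forall f : I -> R, \sum_k a k * `|\sum_(p <- lp k) f p - \sum_(p <- lm k) f p| <=
     \sum_j b j * `|f (s j) - f (t j)|) ->
  forall f : I -> L1, \sum_k a k * l1norm (\sum_(p <- lp k) f p - \sum_(p <- lm k) f p) <=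
     \sum_j b j * l1norm (f (s j) - f (t j)).
Proof.
move=> H f.
have [i1 e1] := l1_Rintegral_sum a (fun k => \sum_(p <- lp k) f p - \sum_(p <- lm k) f p).
have [i2 e2] := l1_Rintegral_sum b (fun j => f (s j) - f (t j)).
rewrite -e1 -e2; apply: le_Rintegral => // x _.
have := H (fun i => f i x).
by under eq_bigr do rewrite -!L1_sumE.
Qed.

End L1.

(** * Transportation cost norm and Lipschitz certificates *)

Section TC.
Variables (R : realType) (X : finType) (d : X -> X -> R).
Hypothesis d_ge0 : forall x y, 0 <= d x y.

Definition dirac_ffun (p : X) : {ffun X -> R} := [ffun x => (p == x)%:R].

Lemma sum_dirac_ffun (f : X -> R) p : \sum_x f x * dirac_ffun p x = f p.
Proof.
rewrite (bigD1 p)//= ffunE eqxx mulr1 big1 ?addr0// => x xp.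
by rewrite ffunE eq_sym (negbTE xp) mulr0.
Qed.

Lemma tcnorm_dirac_le p r : tcnorm X d (dirac_ffun p - dirac_ffun r) <= d p r.
Proof.
apply: ge_inf.
  by exists 0 => _ [l [l0 _ ->]]; rewrite big_seq sumr_ge0// => i /l0 i0; rewrite mulr_ge0.
exists [:: (1, p, r)]; split.
- by move=> z; rewrite inE => /eqP ->.
- by move=> z; rewrite big_seq1 /= !ffunE mul1r.
- by rewrite big_seq1 mul1r.
Qed.

(** The easy half of Kantorovich duality: a Lipschitz function paired with any representation of [m]
    is bounded by the cost of that representation. *)
Lemma tcnorm_ge_lipschitz (f : X -> R) (m : {ffun X -> R}) (x0 : X) :
  @mass0 R X m -> (forall x y, f x - f y <= d x y) ->
  \sum_x f x * m x <= tcnorm X d m.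
Proof.
move=> m0 fL; apply: lb_le_inf.
  (* Every atom is transported to or from [x0]; this representation shows that the infimum runs over
     a nonempty set. *)
  pose r := [seq (`|m x|, (if 0 <= m x then x else x0), (if 0 <= m x then x0 else x)) | x <- enum X].
  exists (\sum_(q <- r) q.1.1 * d q.1.2 q.2); exists r; split=> //.
    by move=> q /mapP[x _ ->] /=.
  move=> z; rewrite big_map big_enum /=.
  have -> : \sum_x `|m x| * (((if 0 <= m x then x else x0) == z)%:R -
      ((if 0 <= m x then x0 else x) == z)%:R) = \sum_x (m x * (x == z)%:R - m x * (x0 == z)%:R).
    apply: eq_bigr => x _; case: ifPn => h; first by rewrite ger0_norm// mulrBr.
    by rewrite ltr0_norm ?ltNge// mulNr -mulrN opprB mulrBr.
  rewrite sumrB -mulr_suml (m0 : \sum_x m x = 0) mul0r subr0.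
  rewrite (bigD1 z)//= eqxx mulr1 big1 ?addr0// => x /negbTE ->.
  by rewrite mulr0.
move=> _ [r [r0 rm ->]].
under eq_bigr do rewrite rm mulr_sumr.
rewrite exchange_big /= big_seq [leRHS]big_seq; apply: ler_sum => q qr.
under eq_bigr do rewrite mulrCA.
rewrite -mulr_sumr; apply: ler_wpM2l; first exact: r0.
under eq_bigr do rewrite mulrBr.
rewrite sumrB; have := fL q.1.2 q.2.
have E p : \sum_x f x * (p == x)%:R = f p.
  by rewrite -[RHS]sum_dirac_ffun; apply: eq_bigr => x _; rewrite ffunE.
by rewrite !E.
Qed.

End TC.

(** [linearization] is applied with [dl p] the Dirac mass at [p]. The functions [g k] certify the
    lower bounds on transportation cost; pairing them with an [m]-fold measure gives [m] times the
    value, as the homogeneous hypothesis demands. *)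
Lemma L1_TC_bound (R : realType) (X : finType) (d : X -> X -> R) (x0 : X) (D : R)
    (dT : measure_display) (T : measurableType dT) (mu : {measure set T -> \bar R})
    (F : {ffun X -> R} -> T -> R)
    (K J : finType) (a : K -> R) (lp lm : K -> seq X) (g : K -> X -> R) (c : K -> R)
    (b : J -> R) (s t : J -> X) :
  (forall x y, 0 <= d x y) -> 0 <= D ->
  (forall f, @mass0 R X f -> mu.-integrable setT (EFin \o F f)) ->
  (forall f g, @mass0 R X f -> @mass0 R X g ->
     ((tcnorm X d (f - g))%:E <= \int[mu]_x (`|F f x - F g x|)%:E)%E /\
     (\int[mu]_x (`|F f x - F g x|)%:E <= (D * tcnorm X d (f - g))%:E)%E) ->
  (forall k, size (lp k) = size (lm k)) ->
  (forall k x y, g k x - g k y <= d x y) ->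
  (forall k, c k <= \sum_(p <- lp k) g k p - \sum_(p <- lm k) g k p) ->
  (forall k, 0 <= a k) -> (forall j, 0 <= b j) ->
  (forall f : X -> R, \sum_k a k * `|\sum_(p <- lp k) f p - \sum_(p <- lm k) f p| <=
     \sum_j b j * `|f (s j) - f (t j)|) ->
  \sum_k a k * c k <= \sum_j b j * (D * d (s j) (t j)).
Proof.
move=> d0 D0 Fi Fd szl gL gc a0 b0 Hlin.
(* Dirac masses do not have mass 0, so [F] is extended to all measures by first removing the total
   mass at [x0]. Only differences of mass 0, which [pr] fixes, matter in the end. *)
pose pr (z : {ffun X -> R}) := z - [ffun x => (\sum_y z y) * (x0 == x)%:R].
have pr0 z : @mass0 R X (pr z).
  rewrite /mass0 /pr; under eq_bigr do rewrite !ffunE.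
  rewrite sumrB -mulr_sumr (_ : \sum_x (x0 == x)%:R = 1) ?mulr1 ?subrr//.
  by rewrite -[RHS](@sum_dirac_ffun R X (fun=> 1) x0); apply: eq_bigr => x _; rewrite ffunE mul1r.
have prB z w : pr z - pr w = pr (z - w).
  apply/ffunP => x; rewrite !ffunE.
  have -> : \sum_y (z - w) y = \sum_y z y - \sum_y w y.
    by rewrite -sumrB; apply: eq_bigr => y _; rewrite !ffunE.
  by ring.
have pr_mass0 z : @mass0 R X z -> pr z = z.
  by move=> z0; apply/ffunP => x; rewrite !ffunE (z0 : \sum_y z y = 0) mul0r oppr0 addr0.
have FL z : F (pr z) \in Lfun mu 1 by apply/Lfun1_integrable/Fi.
pose F' z : LfunType mu (@lexx _ _ 1%E) := Lfun_Sub _ (FL z).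
have F'E z w : (l1norm (F' z - F' w))%:E = (\int[mu]_x (`|F (pr z) x - F (pr w) x|)%:E)%E.
  rewrite /l1norm /Rintegral fineK//.
  by apply: integrable_fin_num => //; exact: L1_integrable_norm.
have up z w : l1norm (F' z - F' w) <= D * tcnorm X d (pr (z - w)).
  by rewrite -lee_fin F'E -prB; apply: (Fd _ _ (pr0 z) (pr0 w)).2.
have lo z w : tcnorm X d (pr (z - w)) <= l1norm (F' z - F' w).
  by rewrite -lee_fin F'E -prB; apply: (Fd _ _ (pr0 z) (pr0 w)).1.
have mass_dirac p : \sum_x @dirac_ffun R X p x = 1.
  by rewrite -[RHS](@sum_dirac_ffun R X (fun=> 1) p); apply: eq_bigr => x _; rewrite mul1r.
have sumE (l : seq X) x : (\sum_(p <- l) @dirac_ffun R X p) x = \sum_(p <- l) @dirac_ffun R X p x.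
  by elim: l => [|p l IH]; rewrite ?big_nil ?ffunE// !big_cons ffunE IH.
apply: (@linearization R _ _ (@l1norm R dT T mu) (@l1normD R dT T mu) (@l1normZ R dT T mu) F'
  _ _ _ _ (@dirac_ffun R X) a lp lm c b s t).
- move=> u; exists (D * tcnorm X d (pr u)) => z.
  by have := up (z + u) z; rewrite [z + u - z]addrAC subrr add0r.
- exact: a0.
- exact: b0.
- move=> k m x; set v := \sum_(p <- lp k) _ - _.
  apply: le_trans (lo _ _); rewrite [x + _ - x]addrAC subrr add0r.
  have pairE (h : X -> R) : \sum_y h y * (v *+ m) y =
      (\sum_(p <- lp k) h p - \sum_(p <- lm k) h p) *+ m.
    have exch (l : seq X) : \sum_y \sum_(p <- l) h y * @dirac_ffun R X p y = \sum_(p <- l) h p.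
      by rewrite exchange_big; apply: eq_bigr => p _; rewrite sum_dirac_ffun.
    rewrite -(exch (lp k)) -(exch (lm k)) -sumrB -sumrMnl; apply: eq_bigr => y _.
    by rewrite /v ffunMnE !ffunE !sumE mulrnAr mulrBr !mulr_sumr.
  have vm0 : @mass0 R X (v *+ m).
    have := pairE (fun=> 1); rewrite !sumr_const_seq szl subrr mul0rn; rewrite /mass0 => e; rewrite -[RHS]e.
    by apply: eq_bigr => y _; rewrite mul1r.
  rewrite pr_mass0//; apply: le_trans (tcnorm_ge_lipschitz x0 vm0 (gL k)).
  by rewrite pairE mulr_natl ler_wMn2r.
- move=> j x; apply: le_trans (up _ _) _; rewrite [x + _ - x]addrAC subrr add0r.
  rewrite pr_mass0; first by rewrite ler_wpM2l// tcnorm_dirac_le.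
  rewrite /mass0 -[RHS](subrr 1) -{1}(mass_dirac (s j)) -(mass_dirac (t j)) -sumrB.
  by apply: eq_bigr => y _; rewrite !ffunE.
- exact: l1_linear_ineq.
Qed.

(** * Potentials and paths in st-graphs *)

Section GraphDist.
Variables (R : realType) (G : stgraph R).
Notation V := (sV G).

Lemma walk_len_nil (x : V) : walk_len R G x [::] = 0.
Proof. by rewrite /walk_len big_nil. Qed.

Lemma walk_len_cons (x y : V) p : walk_len R G x (y :: p) = ulen R G x y + walk_len R G y p.
Proof. by rewrite /walk_len /= big_cons. Qed.

Lemma walk_len_rcons (x y : V) p :
  walk_len R G x (rcons p y) = walk_len R G x p + ulen R G (last x p) y.
Proof.
elim: p x => [|z p IH] x /=; first by rewrite walk_len_cons !walk_len_nil addrC.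
by rewrite !walk_len_cons IH addrA.
Qed.

Hypothesis len_ge0 : forall x y : V, adj G x y -> 0 <= len G x y.

Lemma ulen_ge0 (x y : V) : uadj R G x y -> 0 <= ulen R G x y.
Proof. by rewrite /uadj /ulen; case: ifPn => [/len_ge0//|_ /= /len_ge0]. Qed.

Lemma walk_len_ge0 (x : V) p : path (uadj R G) x p -> 0 <= walk_len R G x p.
Proof.
elim: p x => [|y p IH] x /=; first by rewrite walk_len_nil.
by move=> /andP[xy yp]; rewrite walk_len_cons addr_ge0 ?ulen_ge0 ?IH.
Qed.

Lemma dist_ge0 (x y : V) : 0 <= dist G x y.
Proof.
(* Without any walk the infimum is that of the empty set, which is 0 by convention. *)
rewrite /dist; set A := (X in inf X); have [->|/set0P A0] := eqVneq A set0; first by rewrite inf0.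
by apply: lb_le_inf => // _ [p [pp _ ->]]; exact: walk_len_ge0.
Qed.

Lemma dist_adj_le (x y : V) : adj G x y -> dist G x y <= len G x y.
Proof.
move=> xy; apply: ge_inf.
  by exists 0 => _ [p [pp _ ->]]; exact: walk_len_ge0.
exists [:: y]; split=> //=; first by rewrite /uadj xy.
by rewrite walk_len_cons walk_len_nil addr0 /ulen xy.
Qed.

Lemma lipschitz_dist (f : V -> R) :
  (forall x y, adj G x y -> `|f y - f x| <= len G x y) ->
  forall x y, connect (uadj R G) x y -> f y - f x <= dist G x y.
Proof.
move=> fL x y /connectP[p0 pp0 ->]; apply: lb_le_inf.
  by exists (walk_len R G x p0), p0.
move=> _ [p [pp <- ->]]; elim: p x pp {pp0} => [|z p IH] x /=.
  by rewrite subrr walk_len_nil.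
move=> /andP[xz /IH H]; rewrite walk_len_cons.
suff : f z - f x <= ulen R G x z by lra.
move: xz; rewrite /uadj /ulen; case: ifPn => [/fL|_ /= /fL]; rewrite ler_norml.
  by lra.
by lra.
Qed.

End GraphDist.

Lemma mem_zip_split (T : eqType) (x u v : T) p :
  (u, v) \in zip (x :: p) p -> exists p1 p2, p = p1 ++ v :: p2 /\ last x p1 = u.
Proof.
elim: p x => [|y p IH] x //=; rewrite inE => /orP[/eqP[-> ->]|/IH[p1 [p2 [-> <-]]]].
  by exists [::], p.
by exists (y :: p1), p2.
Qed.

Definition edge (R : realType) (G : stgraph R) : finType :=
  {q : sV G * sV G | adj G q.1 q.2}.

Section StGraph.
Variables (R : realType) (G : stgraph R).
Hypothesis hG : is_stgraph G.
Notation V := (sV G).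
Notation esrc e := (val (e : edge G)).1.
Notation etgt e := (val (e : edge G)).2.

Definition potential (x : V) : R := dist G (s_ G) x.

Lemma potential_s : potential (s_ G) = 0.
Proof.
have [_ [_ [_ _ _ geo _]]] := hG.
by have := geo (s_ G) [::] isT; rewrite walk_len_nil.
Qed.

Lemma potential_t : potential (t_ G) = 1.
Proof. by have [_ [_ []]] := hG. Qed.

Lemma len_gt0 u v : adj G u v -> 0 < len G u v.
Proof. by have [_ [_ [_ H _ _ _]]] := hG; move/H => []. Qed.

Lemma th_gt0_le1 u v : adj G u v -> 0 < th G u v <= 1.
Proof. by have [_ [_ [_ _ _ _ [H _]]]] := hG; move/H. Qed.

(** Positive thickness forces some path of the family to use the edge. *)
Lemma edge_on_st_path u v : adj G u v -> exists p1 p2,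
  [/\ path (adj G) (s_ G) (p1 ++ v :: p2), last (s_ G) p1 = u & last v p2 = t_ G].
Proof.
move=> uv; have [_ [_ [_ _ _ _ [thp [gam [g0 gp gth]]]]]] := hG.
have : (0 < count (fun p => on_path R G (s_ G) p u v) gam)%N.
  have /andP[+ _] := thp u v uv; rewrite gth// lt0n; apply: contraTN => /eqP ->.
  by rewrite mul0r ltxx.
rewrite -has_count => /hasP[p pin /mem_zip_split[p1 [p2 [pE pu]]]].
have [] := gp p pin; rewrite pE last_cat /= => h1 h2.
by exists p1, p2.
Qed.

(** The path from the source to [u], and its extension by the edge, are both directed and hence
    geodesic. *)
Lemma len_potential u v : adj G u v -> len G u v = potential v - potential u.
Proof.
move=> uv; have [p1 [p2 [pp lu lt]]] := edge_on_st_path uv.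
have [_ [_ [_ _ _ geo _]]] := hG.
have pp1 : path (adj G) (s_ G) (rcons p1 v).
  by move: pp; rewrite -cat_rcons cat_path => /andP[].
have := geo _ _ pp1; have : path (adj G) (s_ G) p1.
  by move: pp; rewrite cat_path => /andP[].
move=> /geo; rewrite walk_len_rcons last_rcons lu /ulen uv /potential => -> <-; ring.
Qed.

Lemma potential_lt u v : adj G u v -> potential u < potential v.
Proof. by move=> uv; have := len_gt0 uv; rewrite len_potential// subr_gt0. Qed.

Lemma potential_path x p : path (adj G) x p -> potential x <= potential (last x p).
Proof.
elim: p x => [|y p IH] x //= /andP[/potential_lt xy /IH]; exact/le_trans/ltW.
Qed.

Lemma adj_neq_t u v : adj G u v -> u != t_ G.
Proof.
move=> uv; apply/eqP => ut; have [p1 [p2 [pp lu lt]]] := edge_on_st_path uv.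
have /potential_path : path (adj G) v p2.
  by move: pp; rewrite cat_path /= => /and3P[].
by rewrite lt leNgt -ut potential_lt.
Qed.

Lemma adj_neq_s u v : adj G u v -> v != s_ G.
Proof.
move=> uv; apply/eqP => vs; have [p1 [p2 [pp lu lt]]] := edge_on_st_path uv.
have /potential_path : path (adj G) (s_ G) p1.
  by move: pp; rewrite cat_path /= => /and3P[].
by rewrite lu leNgt -vs potential_lt.
Qed.

Lemma dpath_uniq x p : path (adj G) x p -> uniq (x :: p).
Proof.
move=> pp; apply: (@sorted_uniq _ (fun x y => potential x < potential y)).
- by move=> y1 y2 y3; exact: lt_trans.
- by move=> y; rewrite ltxx.
by apply: sub_path pp => y z; exact: potential_lt.
Qed.

Lemma dpath_zip_adj x p q : path (adj G) x p -> q \in zip (x :: p) p -> adj G q.1 q.2.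
Proof.
case: q => u v pp /mem_zip_split[p1 [p2 [pE lu]]].
by move: pp; rewrite pE cat_path /= lu => /and3P[].
Qed.

Lemma sum_edge_dpath (h : V * V -> R) x p : path (adj G) x p ->
  \sum_(e : edge G) (on_path R G x p (esrc e) (etgt e))%:R * h (val e) =
  \sum_(q <- zip (x :: p) p) h q.
Proof.
move=> pp.
have uz : uniq (zip (x :: p) p) by apply: zip_uniql; exact: dpath_uniq.
rewrite [RHS]big_uniq//= [RHS](@reindex_omap _ _ _ _ (edge G) (val : edge G -> V * V) insub) /=; last first.
  by move=> q qz; rewrite insubT//; exact: dpath_zip_adj qz.
rewrite [RHS](eq_bigl (fun e : edge G => val e \in zip (x :: p) p)); last first.
  by move=> e; rewrite valK eqxx andbT.
rewrite [RHS]big_mkcond /=; apply: eq_bigr => e _.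
by rewrite /on_path -surjective_pairing; case: ifP => _; rewrite ?mul1r ?mul0r.
Qed.

(** The last clause turns thickness-weighted sums over edges into averages of path sums, so that
    identities for single paths transfer to thicknesses. *)
Lemma thickness_family : exists gam : seq (seq V),
  [/\ (0 < size gam)%N,
      (forall p, p \in gam -> path (adj G) (s_ G) p /\ last (s_ G) p = t_ G),
      (forall e : edge G, th G (esrc e) (etgt e) =
         (count (fun p => on_path R G (s_ G) p (esrc e) (etgt e)) gam)%:R / (size gam)%:R) &
      forall h : V * V -> R, \sum_(e : edge G) th G (esrc e) (etgt e) * h (val e) =
        (size gam)%:R^-1 * \sum_(p <- gam) \sum_(q <- zip (s_ G :: p) p) h q].
Proof.
have [_ [_ [_ _ _ _ [_ [gam [g0 gp gth]]]]]] := hG.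
exists gam; split=> // [e|h]; first exact: gth (valP e).
have -> : \sum_(p <- gam) \sum_(q <- zip (s_ G :: p) p) h q = \sum_(p <- gam)
    \sum_(e : edge G) (on_path R G (s_ G) p (esrc e) (etgt e))%:R * h (val e).
  by apply: eq_big_seq => p /gp[pp _]; rewrite sum_edge_dpath.
rewrite exchange_big /= mulr_sumr; apply: eq_bigr => e _.
rewrite gth; last exact: valP e.
rewrite -mulr_suml mulrA; congr (_ * _); rewrite mulrC; congr (_ * _).
elim: (gam) => [|p l IH] /=; first by rewrite big_nil.
by rewrite natrD big_cons IH.
Qed.

Lemma sum_path_telescope (f : V -> R) x p :
  \sum_(q <- zip (x :: p) p) (f q.2 - f q.1) = f (last x p) - f x.
Proof.
elim: p x => [|y p IH] x /=; first by rewrite big_nil subrr.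
by rewrite big_cons IH /= addrC addrA subrK.
Qed.

Lemma sum_th_len : \sum_(e : edge G) th G (esrc e) (etgt e) * len G (esrc e) (etgt e) = 1.
Proof.
have [gam [g0 gp _ gth]] := thickness_family.
under eq_bigr => e _ do rewrite (len_potential (valP e)).
rewrite (gth (fun q => potential q.2 - potential q.1)).
under eq_big_seq => p /gp[_ lp] do rewrite sum_path_telescope lp potential_t potential_s subr0.
by rewrite sumr_const_seq mul1r mulVf// pnatr_eq0 -lt0n.
Qed.

(** Along each path of the family the increments of [f] telescope from source to sink; averaging
    over the family gives the thicknesses. *)
Lemma variation_st (f : V -> R) :
  `|f (t_ G) - f (s_ G)| <= \sum_(e : edge G) th G (esrc e) (etgt e) * `|f (etgt e) - f (esrc e)|.
Proof.
have [gam [g0 gp _ gth]] := thickness_family.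
rewrite (gth (fun q => `|f q.2 - f q.1|)).
have gn0 : 0 < (size gam)%:R :> R by rewrite ltr0n.
rewrite ler_pdivlMl// mulrC -sumr_const_seq big_seq [leRHS]big_seq.
apply: ler_sum => p /gp[pp <-]; rewrite -sum_path_telescope; exact: ler_norm_sum.
Qed.

Lemma th_denominator : exists N : nat, (0 < N)%N /\
  forall e : edge G, exists c : nat, th G (esrc e) (etgt e) * N%:R = c%:R.
Proof.
have [gam [g0 _ gth _]] := thickness_family.
exists (size gam); split=> // e; eexists; rewrite gth divfK ?pnatr_eq0 -?lt0n//.
Qed.

Lemma stgraph_connected x y : connect (uadj R G) x y.
Proof.
have [_ [_ [H _ _ _ _]]] := hG.
by have [p [pp <-]] := H x y; apply/connectP; exists p.
Qed.

(** On an undirected path from the source to [a], each step is controlled by the total variation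
    divided by the thickness of its edge. *)
Lemma variation_connected (a : V) : exists k : R, 0 < k /\ forall f : V -> R,
  `|f a - f (s_ G)| <= k * \sum_(e : edge G) th G (esrc e) (etgt e) * `|f (etgt e) - f (esrc e)|.
Proof.
have th0 (e : edge G) : 0 < th G (esrc e) (etgt e) by have /andP[] := th_gt0_le1 (valP e).
have term (f : V -> R) (e : edge G) : `|f (etgt e) - f (esrc e)| <= (th G (esrc e) (etgt e))^-1 *
    \sum_(e : edge G) th G (esrc e) (etgt e) * `|f (etgt e) - f (esrc e)|.
  rewrite ler_pdivlMl// [leRHS](bigD1 e)//= lerDl sumr_ge0// => e' _.
  by apply: mulr_ge0 => //; exact/ltW/th0.
have /connectP[p + ->] := stgraph_connected (s_ G) a.
elim/last_ind: p => [|p y IH].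
  move=> _; exists 1; split=> // f; rewrite subrr normr0 mul1r sumr_ge0// => e _.
  by apply: mulr_ge0 => //; exact/ltW/th0.
rewrite rcons_path last_rcons => /andP[/IH[k [k0 Hk]] xy].
have [e He] : exists e : edge G, forall f : V -> R,
    `|f y - f (last (s_ G) p)| = `|f (etgt e) - f (esrc e)|.
  case/orP: xy => xy; first by exists (exist _ (_, _) xy).
  by exists (exist _ (_, _) xy) => f; rewrite distrC.
exists (k + (th G (esrc e) (etgt e))^-1); split; first by rewrite addr_gt0// invr_gt0.
move=> f; rewrite mulrDl [leRHS]addrC.
have -> : f y - f (s_ G) = (f y - f (last (s_ G) p)) + (f (last (s_ G) p) - f (s_ G)) by ring.
apply: le_trans (ler_normD _ _) _; apply: lerD; last exact: Hk.
by rewrite He.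
Qed.

(** If all thicknesses were 1, each path of the family would contain every edge, and by
    connectedness every vertex; then [G] would be an st-path. *)
Lemma thin_edge : ~ is_stpath G -> exists e : edge G, th G (esrc e) (etgt e) < 1.
Proof.
move=> nst; apply: contrapT => nthin; apply: nst.
have [gam [g0 gp gth _]] := thickness_family.
have th1 u v : adj G u v -> th G u v = 1.
  move=> uv; have /andP[_ +] := th_gt0_le1 uv; rewrite le_eqVlt => /predU1P[//|lt1].
  by exfalso; apply: nthin; exists (exist _ (u, v) uv).
case: gam g0 gp gth => [//|p gam] _ gp gth; exists p.
have [pp lp] := gp p (mem_head _ _).
have pE u v : adj G u v = ((u, v) \in zip (s_ G :: p) p).
  apply/idP/idP => [uv|]; last exact: dpath_zip_adj.
  have := gth (exist _ (u, v) uv); rewrite /= th1//.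
  move=> /(congr1 ( *%R^~ ((size gam).+1%:R))); rewrite mul1r divfK ?pnatr_eq0//.
  move=> /eqP; rewrite eqr_nat => /eqP cE.
  have := count_size (fun p => on_path R G (s_ G) p u v) gam.
  by move: cE; rewrite {1}/on_path; case: (_ \in _) => //=; rewrite add0n => <-; rewrite ltnn.
have mem u v : adj G u v -> (u \in s_ G :: p) && (v \in s_ G :: p).
  rewrite pE => /mem_zip_split[p1 [p2 [-> <-]]].
  rewrite -cat_cons !mem_cat mem_last /= inE mem_head /=.
  by rewrite orbT.
split=> //; first exact: dpath_uniq.
move=> x; have /connectP[q] := stgraph_connected (s_ G) x.
case/lastP: q => [|q y] /=; first by move=> _ ->; rewrite mem_head.
rewrite rcons_path last_rcons => /andP[_ + ->]; rewrite /uadj.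
by move=> /orP[/mem/andP[]|/mem/andP[]].
Qed.

End StGraph.

(** * Slash products *)

Section SlashStructure.
Variables (R : realType) (H G : stgraph R).
Hypothesis hG : is_stgraph G.

Definition slash_up (x : sV H) : sV (slash H G) := exist (@sl_valid R H G) (inl x) isT.

(* the junk default [sl_s] is returned when [(u, v)] is not an edge of [H] *)
Definition slash_in (u v : sV H) (a : sV G) : sV (slash H G) :=
  insubd (sl_s R H G) (sl_emb R H G u v a).

Lemma st_neq : s_ G != t_ G. Proof. by have [_ []] := hG. Qed.

Lemma val_slash_in u v a : adj H u v -> val (slash_in u v a) = sl_emb R H G u v a.
Proof.
move=> uv; rewrite val_insubd ifT// /sl_emb.
by case: eqVneq => // as_; case: eqVneq => //= at_; rewrite uv as_ at_.
Qed.

Lemma slash_in_s u v : adj H u v -> slash_in u v (s_ G) = slash_up u.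
Proof. by move=> uv; apply: val_inj; rewrite val_slash_in// /sl_emb eqxx. Qed.

Lemma slash_in_t u v : adj H u v -> slash_in u v (t_ G) = slash_up v.
Proof.
move=> uv; apply: val_inj; rewrite val_slash_in// /sl_emb eqxx.
by rewrite eq_sym (negbTE st_neq).
Qed.

Lemma slash_adj u v a b : adj H u v -> adj G a b ->
  adj (slash H G) (slash_in u v a) (slash_in u v b).
Proof.
move=> uv ab; apply/existsP; exists (u, v, a, b).
by rewrite /sl_edge_of uv ab !val_slash_in// !eqxx.
Qed.

Lemma slash_edgeP (x y : sV (slash H G)) : adj (slash H G) x y ->
  exists u v a b, [/\ adj H u v, adj G a b, x = slash_in u v a, y = slash_in u v b
    & len (slash H G) x y = len H u v * len G a b].
Proof.
move=> xy; rewrite /= /sl_len; case: pickP => [[[[u v] a] b]|nq].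
  move=> /and4P[uv ab /eqP xE /eqP yE]; exists u, v, a, b; split=> //.
    by apply: val_inj; rewrite val_slash_in.
  by apply: val_inj; rewrite val_slash_in.
by case/existsP: xy => q; rewrite nq.
Qed.

Lemma slash_vertexP (x : sV (slash H G)) :
  (exists u, x = slash_up u) \/ (exists u v a, adj H u v /\ x = slash_in u v a).
Proof.
case: x => -[u|[[u v] a]] vx; first by left; exists u; apply: val_inj.
right; exists u, v, a; have /and3P[uv as_ at_] := vx; split=> //.
by apply: val_inj; rewrite val_slash_in//= /sl_emb (negbTE as_) (negbTE at_).
Qed.

Lemma slash_connected (z : sV H) :
  (forall x y, connect (uadj R H) x y) -> forall x y, connect (uadj R (slash H G)) x y.
Proof.
move=> cH.
have csym : connect_sym (uadj R (slash H G)).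
  by apply: sym_connect_sym => x y; rewrite /uadj orbC.
have cin u v a b : adj H u v -> connect (uadj R (slash H G)) (slash_in u v a) (slash_in u v b).
  move=> uv; have /connectP[p + ->] := stgraph_connected hG a b.
  elim: p a => [|c p IH] a /=; first by rewrite connect0.
  move=> /andP[ac /IH]; apply: connect_trans; apply: connect1.
  by apply/orP; case/orP: ac => ac; [left|right]; exact: slash_adj.
have cup u v : connect (uadj R (slash H G)) (slash_up u) (slash_up v).
  have /connectP[p + ->] := cH u v.
  elim: p u => [|w p IH] u /=; first by rewrite connect0.
  move=> /andP[uw /IH]; apply: connect_trans.
  case/orP: uw => uw; last rewrite csym.
    by have := cin _ _ (s_ G) (t_ G) uw; rewrite slash_in_s// slash_in_t.
  by have := cin _ _ (s_ G) (t_ G) uw; rewrite slash_in_s// slash_in_t.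
have cz x : connect (uadj R (slash H G)) (slash_up z) x.
  have [[u ->]|[u [v [a [uv ->]]]]] := slash_vertexP x; first exact: cup.
  by apply: connect_trans (cup z u) _; rewrite -(slash_in_s uv) cin.
by move=> x y; apply: connect_trans (cz y); rewrite csym.
Qed.

(** One vertex may lie in several copies, but both endpoints together determine the copy: an edge of
    [G] never leaves the sink nor enters the source, so an ambiguous first endpoint is [u] and an
    ambiguous second one is [v]. *)
Lemma slash_in_inj u v a b u' v' a' b' :
  adj H u v -> adj G a b -> adj H u' v' -> adj G a' b' ->
  slash_in u v a = slash_in u' v' a' -> slash_in u v b = slash_in u' v' b' ->
  [/\ u = u', v = v', a = a' & b = b'].
Proof.
move=> uv ab uv' ab' /(congr1 val) + /(congr1 val).
rewrite !val_slash_in// /sl_emb.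
rewrite (negbTE (adj_neq_t hG ab)) (negbTE (adj_neq_t hG ab')).
rewrite (negbTE (adj_neq_s hG ab)) (negbTE (adj_neq_s hG ab')).
do 4![case: eqVneq => [->|_]] => //.
all: by [move=> [->] [->]|move=> [->] [-> ->]|move=> [-> -> ->] [->]|move=> [-> -> ->] _ ].
Qed.

(* [f] is interpolated along each replaced edge by the potential of [G], and [c u v] scales an
   additional profile [b], meant to vanish at the source and the sink. *)
Definition slash_ext (f : sV H -> R) (c : sV H -> sV H -> R) (b : sV G -> R)
    (x : sV (slash H G)) : R :=
  match val x with
  | inl u => f u
  | inr (u, v, a) => f u + (f v - f u) * potential a + c u v * b a
  end.

Lemma slash_ext_up f c b u : slash_ext f c b (slash_up u) = f u.
Proof. by []. Qed.

Lemma slash_ext_in f c b u v a : b (s_ G) = 0 -> b (t_ G) = 0 -> adj H u v ->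
  slash_ext f c b (slash_in u v a) = f u + (f v - f u) * potential a + c u v * b a.
Proof.
move=> bs bt uv; rewrite /slash_ext val_slash_in// /sl_emb.
case: eqVneq => [->|_]; first by rewrite bs potential_s// !mulr0 !addr0.
case: eqVneq => [->|_//]; rewrite bt potential_t//; ring.
Qed.

End SlashStructure.

(** * Random signs and the coarea inequality *)

Definition sg (R : pzRingType) (b : bool) : R := (-1) ^+ b.
Arguments sg {R} b.

Lemma sgK (R : pzRingType) b : sg b * sg b = 1 :> R.
Proof. by rewrite /sg -expr2 sqrr_sign. Qed.

Section Rademacher.
Variables (R : realType) (I : finType).

Definition flip (i : I) (h : {ffun I -> bool}) : {ffun I -> bool} :=
  [ffun k => (k == i) (+) h k].

Lemma flipK i : involutive (flip i).
Proof. by move=> h; apply/ffunP => k; rewrite !ffunE addbA addbb. Qed.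

Lemma sum_flip_odd i (F : {ffun I -> bool} -> R) :
  (forall h, F (flip i h) = - F h) -> \sum_h F h = 0.
Proof.
move=> FN; have : \sum_h F h = - \sum_h F h; last by lra.
rewrite -sumrN (reindex_inj (inv_inj (flipK i))) /=.
by apply: eq_bigr.
Qed.

Lemma sum_sg i : \sum_(h : {ffun I -> bool}) sg (h i) = 0 :> R.
Proof.
by apply: (@sum_flip_odd i) => h; rewrite ffunE eqxx /sg; case: (h i); rewrite /= ?opprK.
Qed.

Lemma sum_sg2 i j : i != j -> \sum_(h : {ffun I -> bool}) sg (h i) * sg (h j) = 0 :> R.
Proof.
move=> ij; apply: (@sum_flip_odd i) => h; rewrite !ffunE eqxx eq_sym (negbTE ij) /= -mulNr.
by congr (_ * _); rewrite /sg; case: (h i); rewrite /= ?opprK.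
Qed.

(** Cross terms cancel by flipping one sign. In the application [y] is the part of the test coming
    from earlier levels. *)
Lemma rademacher_second_moment (y : R) (x : I -> R) :
  \sum_(h : {ffun I -> bool}) (y + \sum_i sg (h i) * x i) ^+ 2 =
  #|{ffun I -> bool}|%:R * (y ^+ 2 + \sum_i x i ^+ 2).
Proof.
have E (h : {ffun I -> bool}) : (y + \sum_i sg (h i) * x i) ^+ 2 =
    y ^+ 2 + \sum_i (2 * y * x i) * sg (h i) +
    \sum_i \sum_j (x i * x j) * (sg (h i) * sg (h j)).
  rewrite sqrrD; congr (_ + _ + _).
    by rewrite mulr_sumr -sumrMnl; apply: eq_bigr => i _; ring.
  rewrite expr2 mulr_suml; apply: eq_bigr => i _.
  by rewrite mulr_sumr; apply: eq_bigr => j _; ring.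
under eq_bigr do rewrite E.
rewrite !big_split /= sumr_const mulrDr -addrA; congr (_ + _); first by rewrite mulr_natl.
rewrite exchange_big /= big1 ?add0r; last first.
  by move=> i _; rewrite -mulr_sumr sum_sg mulr0.
rewrite exchange_big /= mulr_sumr; apply: eq_bigr => i _.
rewrite exchange_big /= (bigD1 i)//= [X in _ + X]big1 ?addr0; last first.
  by move=> j ji; rewrite -mulr_sumr sum_sg2 ?mulr0// eq_sym.
under eq_bigr do rewrite sgK mulr1.
by rewrite sumr_const mulr_natl expr2.
Qed.

End Rademacher.

Lemma mean_abs_le (R : realType) (I : finType) (X : I -> R) (c : R) : 0 < c ->
  \sum_i X i ^+ 2 <= #|I|%:R * c ^+ 2 -> \sum_i `|X i| <= #|I|%:R * c.
Proof.
move=> c0 H.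
(* Cauchy-Schwarz in its arithmetic-geometric form, tuned to the level [c]. *)
have t (i : I) : `|X i| <= (X i ^+ 2 / c + c) / 2.
  have : 0 <= (`|X i| - c) ^+ 2 by rewrite sqr_ge0.
  rewrite sqrrB real_normK ?num_real// => h.
  rewrite ler_pdivlMr// -(ler_pM2r c0) [leRHS]mulrDl divfK ?gt_eqF//; lra.
apply: le_trans (ler_sum _ (fun i _ => t i)) _.
rewrite -mulr_suml big_split /= -mulr_suml sumr_const -[c *+ _]mulr_natl.
have : (\sum_i X i ^+ 2) / c <= #|I|%:R * c by rewrite ler_pdivrMr// -mulrA -expr2.
by lra.
Qed.

Lemma dyadic_tail_sum (R : realType) (Q : R) (J : nat) :
  \sum_(j < J) (if 2^-1 ^+ j <= Q then 2^-1 ^+ j else 0) <= Num.max 0 (2 * Q).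
Proof.
(* The subtracted term is the remaining geometric tail and lets the induction close; the 0 covers
   the case where no term is selected. *)
suff : \sum_(j < J) (if 2^-1 ^+ j <= Q then 2^-1 ^+ j else 0) <=
    Num.max 0 (2 * Q - 2 * 2^-1 ^+ J) :> R.
  move=> /le_trans; apply; rewrite ge_max !le_max lexx /=; apply/orP; right.
  by rewrite gerBl mulr_ge0// exprn_ge0// invr_ge0.
elim: J => [|J IH]; first by rewrite big_ord0 le_max lexx.
rewrite big_ord_recr /= exprS; move: IH; set S := \sum_(j < J) _.
set p := 2^-1 ^+ J; rewrite mulrA divff// mul1r !le_max => IH.
by case: ifPn => [pQ|]; rewrite -?ltNge => *; apply/orP; case/orP: IH => IH;
  ((left; lra) || (right; lra) || idtac).
Qed.

Section Coarea.
Variables (R : realType) (V W : finType) (L : (V -> R) -> R).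
Variables (p : W -> R) (x y : W -> V) (C : R).
Hypothesis LD : forall f g, L (fun v => f v + g v) <= L f + L g.
Hypothesis LZ : forall c f, 0 <= c -> L (fun v => c * f v) <= c * L f.
Hypothesis Lc : forall c : R, L (fun=> c) <= 0.
Hypothesis Lcut : forall S : pred V,
  L (fun v => (S v)%:R) <= C * \sum_w p w * `|(S (y w))%:R - (S (x w))%:R|.

(* Peel off the layer [m 1_(f <> 0)], where [m] is the least nonzero value of [f]. *)
Lemma coarea_ge0 (f : V -> R) : (forall v, 0 <= f v) ->
  L f <= C * \sum_w p w * `|f (y w) - f (x w)|.
Proof.
have [n] := ubnP #|[pred v | f v != 0]|; elim: n f => // n IH f fn f0.
have [/existsP[v0 v0P]|] := boolP [exists v, f v != 0]; last first.
  rewrite negb_exists => /forallP f00.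
  have -> : f = fun=> 0 by apply/funext => v; apply/eqP; rewrite -[_ == _]negbK f00.
  apply: le_trans (Lc _) _; rewrite big1 ?mulr0// => w _.
  by rewrite subrr normr0 mulr0.
pose m := f [arg min_(v < v0 | f v != 0) f v]%O.
have [m0 mmin] : 0 < m /\ forall v, f v != 0 -> m <= f v.
  rewrite /m; case: arg_minP => // v fv vmin; split=> //.
  by rewrite lt_neqAle eq_sym fv f0.
pose S : pred V := [pred v | f v != 0].
pose g v := f v - m * (S v)%:R.
have g0 v : 0 <= g v.
  rewrite /g /S /=; case: (eqVneq (f v) 0) => [->|fv] /=; first by rewrite mulr0 subr0.
  by rewrite mulr1 subr_ge0 mmin.
have gn : (#|[pred v | g v != 0%R]| < n)%N.
  rewrite -ltnS; apply: leq_trans fn; rewrite ltnS; apply: proper_card.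
  apply/properP; split.
    apply/fintype.subsetP => v; rewrite !inE; apply: contraNN => /eqP fv.
    by rewrite /g /S /= fv eqxx mulr0 subr0.
  exists [arg min_(v < v0 | f v != 0) f v]%O; first by rewrite inE -/m gt_eqF.
  by rewrite inE negbK /g /S /= -/m (gt_eqF m0) mulr1 subrr.
have -> : f = fun v => m * (S v)%:R + g v by apply/funext => v; rewrite /g addrC subrK.
apply: le_trans (LD _ _) _.
apply: le_trans (lerD (LZ _ (ltW m0)) (IH g gn g0)) _.
apply: le_trans (lerD (ler_wpM2l (ltW m0) (Lcut S)) (lexx _)) _.
rewrite mulrCA -mulrDr; rewrite [m * \sum_w _]mulr_sumr -big_split /=.
rewrite le_eqVlt; apply/orP; left; apply/eqP; congr (_ * _); apply: eq_bigr => w _.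
rewrite mulrCA -mulrDr; congr (_ * _).
(* The remainder [g] is nonnegative and vanishes off [S], so [g] and the indicator of [S] vary in
   the same direction on every pair and their variations add. *)
have gS v : ~~ S v -> g v = 0.
  by rewrite /g /S /= negbK => /eqP ->; rewrite eqxx mulr0 subr0.
move: (g0 (y w)) (g0 (x w)) (gS (y w)) (gS (x w)) => {gS}.
case: (S (y w)) (S (x w)) => -[] //= gy gx.
- by move=> _ _; rewrite !mulr1 subrr normr0 mulr0 add0r; congr `|_|; ring.
- move=> _ /(_ isT) ->; rewrite mulr1 mulr0 addr0 !subr0 normr1 mulr1.
  by rewrite (ger0_norm gy) ger0_norm// addr_ge0// ltW.
- move=> /(_ isT) -> _; rewrite mulr1 mulr0 addr0 !sub0r !normrN normr1 mulr1.
  by rewrite (ger0_norm gx) ger0_norm// addr_ge0// ltW.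
by move=> /(_ isT) -> /(_ isT) ->; rewrite !mulr0 !subrr !normr0 mulr0 addr0.
Qed.

Lemma coarea (f : V -> R) : L f <= C * \sum_w p w * `|f (y w) - f (x w)|.
Proof.
pose K := \sum_v `|f v|.
have g0 v : 0 <= f v + K.
  have : - f v <= K; last by lra.
  apply: le_trans (_ : `|f v| <= _); first by rewrite -normrN ler_norm.
  by rewrite /K (bigD1 v)//= lerDl sumr_ge0.
have -> : f = fun v => (f v + K) + - K by apply/funext => v; rewrite addrK.
apply: le_trans (LD _ _) _; rewrite -[leRHS]addr0; apply: lerD; last exact: Lc.
apply: le_trans (coarea_ge0 g0) _; rewrite le_eqVlt; apply/orP; left; apply/eqP.
by congr (_ * _); apply: eq_bigr => w _; rewrite !addrK; congr (_ * `|_|); ring.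
Qed.

End Coarea.

(** * Edges of slash powers as words *)

Section Words.
Variables (R : realType) (G : stgraph R).
Hypothesis hG : is_stgraph G.
Notation E := (edge G).
Notation esrc e := (val (e : E)).1.
Notation etgt e := (val (e : E)).2.
Notation Gn n := (slash_pow G n).

(* [word n] indexes the edges of the [n]-th slash power: the letters are the edges of [G]
   chosen at the successive levels of the replacement. *)
Fixpoint word (n : nat) : finType :=
  if n is m.+1 then (word m * E)%type else unit.

Fixpoint ends (n : nat) : word n -> sV (Gn n) * sV (Gn n) :=
  match n with
  | 0 => fun _ => (false, true)
  | m.+1 => fun w => (slash_in (ends w.1).1 (ends w.1).2 (esrc w.2),
                      slash_in (ends w.1).1 (ends w.1).2 (etgt w.2))
  end.

Fixpoint wth (n : nat) : word n -> R :=
  match n with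
  | 0 => fun _ => 1
  | m.+1 => fun w => wth w.1 * th G (esrc w.2) (etgt w.2)
  end.

Fixpoint wlen (n : nat) : word n -> R :=
  match n with
  | 0 => fun _ => 1
  | m.+1 => fun w => wlen w.1 * len G (esrc w.2) (etgt w.2)
  end.

Lemma adj_ends n (w : word n) : adj (Gn n) (ends w).1 (ends w).2.
Proof.
elim: n w => [//|n IH] w; apply: slash_adj; [exact: IH|exact: (valP w.2)].
Qed.

Lemma ends_surj n x y : adj (Gn n) x y -> exists w : word n, ends w = (x, y).
Proof.
elim: n x y => [|n IH] x y; first by case: x y => -[] // _; exists tt.
move=> /slash_edgeP[u [v [a [b [uv ab -> -> _]]]]].
have [w wE] := IH u v uv; exists (w, exist _ (a, b) ab).
by rewrite /= wE.
Qed.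

Lemma ends_inj n : injective (@ends n).
Proof.
elim: n => [[] []//|n IH] [w [[a b] ab]] [w' [[a' b'] ab']] /= [h1 h2].
have [eu ev ea eb] := slash_in_inj hG (adj_ends w) ab (adj_ends w') ab' h1 h2.
have -> : w = w'.
  by apply: IH; rewrite [LHS]surjective_pairing [RHS]surjective_pairing eu ev.
by move: ea eb => /= ea eb; congr pair; apply: val_inj; rewrite /= ea eb.
Qed.

Lemma wth_gt0 n (w : word n) : 0 < wth w.
Proof.
elim: n w => [//|n IH] w /=; rewrite mulr_gt0//.
by have /andP[] := th_gt0_le1 hG (valP w.2).
Qed.

Lemma wlen_gt0 n (w : word n) : 0 < wlen w.
Proof. by elim: n w => [//|n IH] w /=; rewrite mulr_gt0// (len_gt0 hG (valP w.2)). Qed.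

Lemma sum_word n (F : word n.+1 -> R) : \sum_w F w = \sum_(w : word n) \sum_(e : E) F (w, e).
Proof. by rewrite pair_big /=; apply: eq_bigr => -[w e]. Qed.

(** The weights [wth w * wlen w] form a product probability distribution: the letters of a random
    word are independent with weights thickness times length. *)
Lemma sum_wth_wlen n : \sum_(w : word n) wth w * wlen w = 1.
Proof.
elim: n => [|n IH]; first by rewrite (big_pred1 tt) ?mulr1// => -[].
rewrite sum_word -[RHS]IH; apply: eq_bigr => w _ /=.
under eq_bigr do rewrite mulrACA.
by rewrite -mulr_sumr sum_th_len// mulr1.
Qed.

(** This is the expected thickness of a random word, multiplicative because the letters are
    independent. *)
Lemma sum_wth2_wlen n : \sum_(w : word n) wth w ^+ 2 * wlen w =
  (\sum_(e : E) th G (esrc e) (etgt e) ^+ 2 * len G (esrc e) (etgt e)) ^+ n.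
Proof.
elim: n => [|n IH]; first by rewrite (big_pred1 tt) ?expr0 /= ?expr1n ?mulr1// => -[].
rewrite sum_word exprSr -IH mulr_suml; apply: eq_bigr => w _ /=.
by rewrite mulr_sumr; apply: eq_bigr => e _; rewrite exprMn; ring.
Qed.

Lemma wth_denominator : exists N : nat, (0 < N)%N /\
  forall n (w : word n), exists c : nat, wth w * N%:R ^+ n = c%:R.
Proof.
have [N [N0 HN]] := th_denominator hG; exists N; split=> //.
elim=> [|n IH] w; first by exists 1%N; rewrite mulr1.
have [c cE] := IH w.1; have [c' cE'] := HN w.2; exists (c * c')%N.
by rewrite /= exprSr mulrACA cE cE' natrM.
Qed.

Fixpoint gpot (n : nat) : sV (Gn n) -> R :=
  match n with
  | 0 => fun x : bool => x%:R
  | m.+1 => @slash_ext R (Gn m) G (@gpot m) (fun _ _ => 0) (fun=> 0)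
  end.

(** The length of an edge of a slash product is read off a picked representation. Writing it as a
    difference of [gpot] makes it depend on the endpoints alone. *)
Lemma len_slash_pow n x y : adj (Gn n) x y -> len (Gn n) x y = gpot y - gpot x.
Proof.
elim: n x y => [|n IH] x y; first by case: x y => -[] //= _; rewrite subr0.
move=> /slash_edgeP[u [v [a [b [uv ab -> -> ->]]]]].
by rewrite IH// (len_potential hG ab) /= !slash_ext_in//; ring.
Qed.

Lemma wlenE n (w : word n) : wlen w = gpot (ends w).2 - gpot (ends w).1.
Proof.
elim: n w => [|n IH] w /=; first by rewrite subr0.
by rewrite IH (len_potential hG (valP w.2)) !slash_ext_in ?adj_ends//; ring.
Qed.

Lemma len_ends n (w : word n) : len (Gn n) (ends w).1 (ends w).2 = wlen w.
Proof. by rewrite len_slash_pow ?adj_ends// wlenE. Qed.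

Lemma len_slash_pow_gt0 n x y : adj (Gn n) x y -> 0 < len (Gn n) x y.
Proof. by move=> /ends_surj[w wE]; have := wlen_gt0 w; rewrite -len_ends wE. Qed.

Lemma slash_pow_connected n x y : connect (uadj R (Gn n)) x y.
Proof.
elim: n x y => [|n IH]; last exact: slash_connected (s_ _) IH.
by case=> -[]; rewrite ?connect0 ?connect1.
Qed.

Lemma card_slash_pow : exists K : nat, (1 < K)%N /\ forall n, (#|sV (Gn n)| <= K ^ n.+1)%N.
Proof.
(* [K] dominates the number of edges, the number of vertices and 2; the factor 2 absorbs the sum of
   old and new vertices at each level. *)
pose K := (#|E| + #|sV G| + 2)%N; exists K; split; first by rewrite /K addn2.
have cw n : #|word n| = (#|E| ^ n)%N.
  by elim: n => [|n IH]; rewrite ?card_unit// card_prod IH expnSr.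
have cV n : (#|sV (Gn n.+1)| <= #|sV (Gn n)| + #|word n| * #|sV G|)%N.
  pose F (z : sV (Gn n) + word n * sV G) : sV (Gn n.+1) :=
    match z with inl u => slash_up G u | inr (w, a) => slash_in (ends w).1 (ends w).2 a end.
  have Fs x : x \in codom F.
    have [[u ->]|[u [v [a [uv ->]]]]] := slash_vertexP x.
      by rewrite -[slash_up G u]/(F (inl u)) codom_f.
    have [w wE] := ends_surj uv.
    rewrite (_ : slash_in u v a = F (inr (w, a))) ?codom_f//.
    by rewrite /F wE.
  rewrite -card_prod -card_sum; apply: leq_trans (leq_image_card F predT).
  by apply: subset_leq_card; apply/fintype.subsetP => x _; exact: Fs.
elim=> [|n IH]; first by rewrite card_bool expn1 /K addn2.
apply: leq_trans (cV n) _; rewrite cw.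
have EK : (#|E| <= K)%N by rewrite /K -addnA leq_addr.
have VK : (#|sV G| <= K)%N by rewrite /K addnAC leq_addl.
have K2 : (1 < K)%N by rewrite /K addn2.
have EKn : (#|E| ^ n <= K ^ n)%N by case: (n) => // m; rewrite leq_exp2r.
apply: leq_trans (leq_add IH (leq_mul EKn VK)) _.
by rewrite -expnSr addnn -mul2n [in leqRHS]expnS leq_mul2r K2 orbT.
Qed.

End Words.

(** * Stopped edges and test functionals *)

Section IntegralFunctional.
Variable R : realType.

(** Integration against an integer-valued measure of mass 0, in the form of lists of atoms that
    [linearization] takes. *)
Definition integral_functional (V : Type) (F : (V -> R) -> R) : Prop :=
  exists lp lm : seq V, size lp = size lm /\
    forall f, F f = \sum_(p <- lp) f p - \sum_(p <- lm) f p.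

Lemma integral_functional0 (V : Type) : integral_functional (fun _ : V -> R => 0).
Proof. by exists [::], [::]; split=> // f; rewrite !big_nil subrr. Qed.

Lemma integral_functionalD (V : Type) (F1 F2 : (V -> R) -> R) :
  integral_functional F1 -> integral_functional F2 ->
  integral_functional (fun f => F1 f + F2 f).
Proof.
move=> [p1 [m1 [s1 E1]]] [p2 [m2 [s2 E2]]]; exists (p1 ++ p2), (m1 ++ m2).
by rewrite !size_cat s1 s2; split=> // f; rewrite E1 E2 !big_cat /=; ring.
Qed.

Lemma integral_functionalN (V : Type) (F : (V -> R) -> R) :
  integral_functional F -> integral_functional (fun f => - F f).
Proof. by move=> [p [m [s E]]]; exists m, p; split=> // f; rewrite E opprB. Qed.

Lemma integral_functionalMn (V : Type) (F : (V -> R) -> R) (c : nat) :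
  integral_functional F -> integral_functional (fun f => c%:R * F f).
Proof.
move=> FI; elim: c => [|c IH].
  rewrite (_ : (fun _ => _) = fun=> 0); first exact: integral_functional0.
  by apply/funext => f; rewrite mul0r.
rewrite (_ : (fun _ => _) = fun f => F f + c%:R * F f); first exact: integral_functionalD.
by apply/funext => f; rewrite mulrS mulrDl mul1r.
Qed.

Lemma integral_functional_sum (V I : Type) (s : seq I) (F : I -> (V -> R) -> R) :
  (forall i, integral_functional (F i)) ->
  integral_functional (fun f => \sum_(i <- s) F i f).
Proof.
move=> FI; elim: s => [|i s IH].
  rewrite (_ : (fun _ => _) = fun=> 0); first exact: integral_functional0.
  by apply/funext => f; rewrite big_nil.
rewrite (_ : (fun _ => _) = fun f => F i f + \sum_(i <- s) F i f).
  exact: integral_functionalD.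
by apply/funext => f; rewrite big_cons.
Qed.

Lemma integral_functional_comp (V V' : Type) (g : V -> V') (F : (V -> R) -> R) :
  integral_functional F -> integral_functional (fun f => F (fun v => f (g v))).
Proof.
move=> [p [m [s E]]]; exists (map g p), (map g m); rewrite !size_map.
by split=> // f; rewrite E !big_map.
Qed.

Lemma integral_functional_diff (V : Type) (x y : V) :
  integral_functional (fun f => f x - f y).
Proof. by exists [:: x], [:: y]; split=> // f; rewrite !big_seq1. Qed.

Lemma integral_functional_sg (V : Type) (b : bool) (F : (V -> R) -> R) :
  integral_functional F -> integral_functional (fun f => sg b * F f).
Proof.
case: b => FI; rewrite /sg.
  rewrite (_ : (fun _ => _) = fun f => - F f); first exact: integral_functionalN.
  by apply/funext => f; rewrite mulN1r.
by rewrite (_ : (fun _ => _) = F)//; apply/funext => f; rewrite mul1r.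
Qed.

End IntegralFunctional.

Section Tests.
Variables (R : realType) (G : stgraph R).
Hypothesis hG : is_stgraph G.
Notation E := (edge G).
Notation esrc e := (val (e : E)).1.
Notation etgt e := (val (e : E)).2.
Notation Gn n := (slash_pow G n).
Variables (a : sV G) (tau : R).
Hypotheses (a_neq_s : a != s_ G) (a_neq_t : a != t_ G).

Definition dead n (w : word G n) : bool := wth w <= tau.

(** The empty word has no parent, whence the value false: it is itself stopped when [tau] is 1. *)
Definition pdead n : word G n -> bool :=
  match n with 0 => fun=> false | m.+1 => fun w => dead w.1 end.

(* a word is stopped when its thickness has just dropped below the threshold [tau] *)
Definition stopped n (w : word G n) : bool := dead w && ~~ pdead w.

Definition mid n (w : word G n) : sV (Gn n.+1) := slash_in (ends w).1 (ends w).2 a.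

Fixpoint signs (n : nat) : finType :=
  if n is m.+1 then (signs m * {ffun word G m -> bool})%type else unit.

Definition tterm n (f : sV (Gn n.+1) -> R) (w : word G n) : R :=
  (stopped w)%:R * (wth w * (f (mid w) - f (slash_up G (ends w).1))).

(** The random functional of the threshold [tau], for fixed signs [h]. Terms of earlier levels only
    see the restriction of [f] to older vertices. *)
Fixpoint test n : (sV (Gn n) -> R) -> signs n -> R :=
  match n with
  | 0 => fun _ _ => 0
  | m.+1 => fun f h => test (fun x => f (slash_up G x)) h.1 + \sum_w sg (h.2 w) * tterm f w
  end.

Fixpoint sq_test n : (sV (Gn n) -> R) -> R :=
  match n with
  | 0 => fun _ => 0
  | m.+1 => fun f => sq_test (fun x => f (slash_up G x)) + \sum_w tterm f w ^+ 2
  end.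

Fixpoint abs_test n : (sV (Gn n) -> R) -> R :=
  match n with
  | 0 => fun _ => 0
  | m.+1 => fun f => abs_test (fun x => f (slash_up G x)) + \sum_w `|tterm f w|
  end.

Definition edge_variation n (f : sV (Gn n) -> R) : R :=
  \sum_(w : word G n) wth w * `|f (ends w).2 - f (ends w).1|.

Lemma test_linear n (c : R) f g (h : signs n) :
  test (fun v => c * f v + g v) h = c * test f h + test g h.
Proof.
elim: n f g h => [|n IH] f g h /=; first by rewrite mulr0 addr0.
rewrite IH mulrDr addrACA; congr (_ + _); rewrite mulr_sumr -big_split /=.
by apply: eq_bigr => w _; rewrite /tterm; ring.
Qed.

Lemma test_const n (c : R) (h : signs n) : test (fun=> c) h = 0.
Proof.
elim: n h => [//|n IH] h /=; rewrite IH add0r big1// => w _.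
by rewrite /tterm subrr !mulr0.
Qed.

(** Thicknesses of words of length [n] have denominator [N ^ n], so a power of [N] clears all
    coefficients; the factor is divided out again in the final weights. *)
Lemma test_integral : exists N : nat, (0 < N)%N /\
  forall n (h : signs n), integral_functional (fun f => N%:R ^+ n * test f h).
Proof.
have [N [N0 HN]] := wth_denominator hG; exists N; split=> //.
elim=> [|n IH] h.
  rewrite (_ : (fun _ => _) = fun=> 0); first exact: integral_functional0.
  by apply/funext => f; rewrite mulr0.
have -> : (fun f => N%:R ^+ n.+1 * test f h) = fun f : sV (Gn n.+1) -> R =>
    N%:R * (N%:R ^+ n * test (fun x => f (slash_up G x)) h.1) +
    \sum_w N%:R * (sg (h.2 w) * (N%:R ^+ n * tterm f w)).
  apply/funext => f; rewrite exprS /= mulrDr mulrA; congr (_ + _).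
  by rewrite mulr_sumr; apply: eq_bigr => w _; ring.
apply: integral_functionalD.
  apply: integral_functionalMn.
  exact: (integral_functional_comp (slash_up G) (IH h.1)).
apply: integral_functional_sum => w; apply: integral_functionalMn.
apply: integral_functional_sg.
have [c cE] := HN n w.
rewrite (_ : (fun _ => _) = fun f => (stopped w)%:R * (c%:R *
  (f (mid w) - f (slash_up G (ends w).1)))).
  by apply/integral_functionalMn/integral_functionalMn/integral_functional_diff.
by apply/funext => f; rewrite /tterm -cE; ring.
Qed.

Lemma test_second_moment n (f : sV (Gn n) -> R) :
  \sum_(h : signs n) test f h ^+ 2 = #|signs n|%:R * sq_test f.
Proof.
elim: n f => [|n IH] f; first by rewrite mulr0 big1// => h _; rewrite expr0n.
transitivity (\sum_(h : signs n) \sum_(k : {ffun word G n -> bool})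
    (test (fun x => f (slash_up G x)) h + \sum_w sg (k w) * tterm f w) ^+ 2).
  by rewrite pair_big; apply: eq_bigr => -[h k].
under eq_bigr do rewrite rademacher_second_moment.
rewrite -mulr_sumr big_split /= IH sumr_const card_prod natrM -mulr_natl; ring.
Qed.

(** * Estimates for the tests on cuts and by total variation *)

Variables (th0 k r : R).
Hypotheses (tau_gt0 : 0 < tau) (tau_le1 : tau <= 1).
Hypotheses (th0_gt0 : 0 < th0) (th0_le1 : th0 <= 1) (th0_le : forall e : E, th0 <= th G (esrc e) (etgt e)).
Hypotheses (k_ge1 : 1 <= k) (k_var : forall f : sV G -> R, `|f a - f (s_ G)| <=
  k * \sum_(e : E) th G (esrc e) (etgt e) * `|f (etgt e) - f (esrc e)|).
Hypotheses (r_ge0 : 0 <= r) (r_le : forall e : E, r <= len G (esrc e) (etgt e)).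

Lemma th_le1 (e : E) : th G (esrc e) (etgt e) <= 1.
Proof. by have /andP[] := th_gt0_le1 hG (valP e). Qed.

Lemma norm_tterm_cut n (S : pred (sV (Gn n.+1))) (w : word G n) :
  `|tterm (fun v => (S v)%:R) w| = 0 \/
  (stopped w /\ `|tterm (fun v => (S v)%:R) w| = wth w).
Proof.
rewrite /tterm; have [sw|_] := boolP (stopped w); last by left; rewrite mul0r normr0.
rewrite mul1r normrM (gtr0_norm (wth_gt0 hG w)).
case: (S _) (S _) => -[]; rewrite ?subrr ?subr0 ?sub0r ?normrN ?normr0 ?normr1 ?mulr0 ?mulr1.
- by left.
- by right.
- by right.
- by left.
Qed.

(** On a cut each nonzero term is the thickness of a stopped word, hence at most [tau], and its
    square is at most [tau] times itself. *)
Lemma sq_test_cut n (S : pred (sV (Gn n))) :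
  sq_test (fun v => (S v)%:R) <= tau * abs_test (fun v => (S v)%:R).
Proof.
elim: n S => [|n IH] S /=; first by rewrite mulr0.
rewrite mulrDr; apply: lerD; first exact: (IH (fun x => S (slash_up G x))).
rewrite mulr_sumr; apply: ler_sum => w _.
rewrite -real_normK ?num_real// expr2; apply: ler_wpM2r => //.
have [->|[/andP[dw _] ->]] := norm_tterm_cut S w; first exact: ltW.
exact: dw.
Qed.

(** The parent of a stopped word is thicker than [tau] and the last letter costs at most a factor
    [th0]; the empty word has thickness 1. *)
Lemma stopped_wth n (w : word G n) : stopped w -> th0 * tau <= wth w.
Proof.
case: n w => [|n] w /andP[_]; rewrite /= /dead.
  by move=> _; rewrite mulr_ile1// ltW.
rewrite -ltNge => tw; rewrite mulrC.
by apply: ler_pM; [exact: ltW|exact: ltW|exact: ltW|exact: th0_le].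
Qed.

Lemma abs_test_cut n (S : pred (sV (Gn n))) :
  abs_test (fun v => (S v)%:R) = 0 \/ th0 * tau <= abs_test (fun v => (S v)%:R).
Proof.
elim: n S => [|n IH] S /=; first by left.
have [->|h] := IH (fun x => S (slash_up G x)); last first.
  by right; apply: le_trans h _; rewrite lerDl sumr_ge0.
rewrite add0r; have [/existsP[w sw]|] := boolP [exists w, stopped w &&
    (`|tterm (fun v => (S v)%:R) w| != 0)].
  right; have /andP[st nz] := sw.
  rewrite (bigD1 w)//=; have [h|[_ ->]] := norm_tterm_cut S w; first by rewrite h eqxx in nz.
  by apply: le_trans (stopped_wth st) _; rewrite lerDl sumr_ge0.
rewrite negb_exists => /forallP nz; left; rewrite big1// => w _.
have [//|[st e]] := norm_tterm_cut S w.
by have := nz w; rewrite st /= negbK => /eqP.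
Qed.

Definition dead_variation n (f : sV (Gn n) -> R) : R :=
  \sum_(w : word G n) (pdead w)%:R * (wth w * `|f (ends w).2 - f (ends w).1|).

Lemma pdead_dead n (w : word G n) : pdead w -> dead w.
Proof.
case: n w => [//|n] w /=; rewrite /dead /= => dw; apply: le_trans dw.
by rewrite ler_piMr ?th_le1// ltW// wth_gt0.
Qed.

(** Each stopped word is charged to the variation inside its own copy of [G], by [k_var]. Variation
    below words stopped earlier only grows under refinement, by [variation_st]. Restricting to words
    with a dead parent keeps the charges disjoint. *)
Lemma abs_test_dead_variation n (f : sV (Gn n) -> R) : abs_test f <= k * dead_variation f.
Proof.
elim: n f => [|n IH] f /=; first by rewrite /dead_variation big1 ?mulr0// => w _; rewrite mul0r.
apply: le_trans (lerD (IH _) (lexx _)) _.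
rewrite /dead_variation sum_word !mulr_sumr -big_split /=; apply: ler_sum => w _.
rewrite -mulr_sumr [X in _ <= _ * (_ * X)](_ : _ = wth w * \sum_(e : E)
    th G (esrc e) (etgt e) * `|f (slash_in (ends w).1 (ends w).2 (etgt e)) -
      f (slash_in (ends w).1 (ends w).2 (esrc e))|); last first.
  by rewrite mulr_sumr; apply: eq_bigr => e _; rewrite mulrA.
have uv := adj_ends w.
have := variation_st hG (fun x => f (slash_in (ends w).1 (ends w).2 x)).
have := k_var (fun x => f (slash_in (ends w).1 (ends w).2 x)).
rewrite slash_in_t// slash_in_s// -/(mid w); set S := \sum_(e : E) _ => h1 h2.
have w0 := ltW (wth_gt0 hG w).
have S0 : 0 <= S by apply: le_trans h2.
rewrite /tterm /stopped; have [pw|pw] := boolP (pdead w).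
  rewrite (pdead_dead pw) /= !mul1r mul0r normr0 addr0; apply: ler_wpM2l; first exact: le_trans ler01 k_ge1.
  exact: ler_wpM2l.
rewrite /= mul0r mulr0 add0r andbT; case: (dead w) => /=; last first.
  by rewrite !mul0r normr0 mulr0.
rewrite !mul1r normrM (ger0_norm w0) mulrCA; exact: ler_wpM2l.
Qed.

Lemma abs_test_variation n (f : sV (Gn n) -> R) : abs_test f <= k * edge_variation f.
Proof.
apply: le_trans (abs_test_dead_variation f) _; apply: ler_wpM2l; first exact: le_trans ler01 k_ge1.
apply: ler_sum => w _; rewrite -[leRHS]mul1r; apply: ler_wpM2r.
  by rewrite mulr_ge0// ltW// wth_gt0.
by case: (pdead w).
Qed.

(** The probability that a random word is stopped at some length below [n]. *)
Fixpoint stopped_mass n : R :=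
  if n is m.+1 then stopped_mass m + \sum_(w : word G m) (stopped w)%:R * (wth w * wlen w) else 0.

Lemma stopped_mass_compl n :
  stopped_mass n + \sum_(w : word G n) (~~ pdead w)%:R * (wth w * wlen w) = 1.
Proof.
elim: n => [|n IH]; first by rewrite add0r (big_pred1 tt) ?mul1r// => -[].
rewrite -[RHS]IH /= -addrA; congr (_ + _); rewrite sum_word -big_split /=.
apply: eq_bigr => w _; rewrite -mulr_sumr.
rewrite [X in _ + _ * X](_ : _ = wth w * wlen w); last first.
  under eq_bigr do rewrite mulrACA.
  by rewrite -mulr_sumr sum_th_len// mulr1.
rewrite -mulrDl; congr (_ * _); rewrite /stopped.
have := @pdead_dead n w; case: (pdead w) => [/(_ isT) ->|_] /=; first by rewrite addr0.
by case: (dead w); rewrite /= ?addr0 ?add0r.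
Qed.

(** Markov's inequality for the thickness of a random word of length [n]: a word of length [n.+1]
    escapes only if its parent is thicker than [tau]. *)
Lemma stopped_mass_ge n : 1 - (\sum_(e : E) th G (esrc e) (etgt e) ^+ 2 *
  len G (esrc e) (etgt e)) ^+ n / tau <= stopped_mass n.+1.
Proof.
rewrite -(stopped_mass_compl n.+1) lerBlDr lerD2l sum_word -sum_wth2_wlen// mulr_suml.
apply: ler_sum => w _ /=; rewrite -mulr_sumr.
rewrite [X in _ * X](_ : _ = wth w * wlen w); last first.
  under eq_bigr do rewrite mulrACA.
  by rewrite -mulr_sumr sum_th_len// mulr1.
have w0 := wth_gt0 hG w; have l0 := wlen_gt0 hG w.
rewrite /dead; case: (leP (wth w) tau) => [_|tw] /=.
  by rewrite mul0r mulr_ge0 ?invr_ge0 ?mulr_ge0 ?exprn_ge0// ltW.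
rewrite mul1r ler_pdivlMr// expr2 -!mulrA; apply: ler_wpM2l; first exact: ltW.
by rewrite mulrC; apply: ler_wpM2r; exact: ltW.
Qed.

(* [tfun h] certifies the transportation cost of the test measure with signs [h]: it is zero until
   a word is stopped, has a bump of sign [h] at its middle vertex, and is then interpolated. *)
Fixpoint tfun n : signs n -> sV (Gn n) -> R :=
  match n with
  | 0 => fun _ _ => 0
  | m.+1 => fun h => @slash_ext R (Gn m) G (tfun h.1)
      (fun u v => \sum_(w : word G m | ends w == (u, v))
         sg (h.2 w) * ((stopped w)%:R * (r * wlen w)))
      (fun x => (x == a)%:R)
  end.

Lemma tfun_in n (h : signs n.+1) (w : word G n) x :
  tfun h (slash_in (ends w).1 (ends w).2 x) = tfun h.1 (ends w).1 +
    (tfun h.1 (ends w).2 - tfun h.1 (ends w).1) * potential x +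
    sg (h.2 w) * ((stopped w)%:R * (r * wlen w)) * (x == a)%:R.
Proof.
rewrite [LHS]/= slash_ext_in ?adj_ends//; last 2 first.
- by rewrite eq_sym (negbTE a_neq_s).
- by rewrite eq_sym (negbTE a_neq_t).
congr (_ + _ * _); rewrite (big_pred1 w)// => w'.
by rewrite -surjective_pairing /= (inj_eq (@ends_inj _ _ hG n)).
Qed.

(** No ancestor of such a word is stopped, so no bump has been placed on the copies leading to it
    and interpolation preserves equality at the ends. *)
Lemma tfun_flat n (h : signs n) (w : word G n) : ~~ pdead w ->
  tfun h (ends w).1 = tfun h (ends w).2.
Proof.
elim: n h w => [//|n IH] h w /= dw.
have pw : ~~ pdead w.1 by apply: contra dw; exact: pdead_dead.
have := tfun_in h w.1; rewrite /= => inE.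
by rewrite !inE (IH _ _ pw) /stopped (negbTE dw) /= !mul0r !mulr0 !mul0r subrr !mul0r.
Qed.

(** Interpolation keeps the slope of an unstopped word. On a stopped word the base is flat, and the
    bump has height [r * wlen w], at most the length of any new edge. *)
Lemma tfun_lipschitz n (h : signs n) x y : adj (Gn n) x y ->
  `|tfun h y - tfun h x| <= len (Gn n) x y.
Proof.
elim: n h x y => [|n IH] h x y; first by move=> _; rewrite /= subrr normr0.
move=> /slash_edgeP[u [v [b [c [uv bc -> -> ->]]]]].
have [w wE] := ends_surj uv; have -> : u = (ends w).1 by rewrite wE.
have -> : v = (ends w).2 by rewrite wE.
rewrite len_ends// !tfun_in.
have [st|nst] := boolP (stopped w); last first.
  rewrite !mul0r !mulr0 !mul0r !addr0.
  have := IH h.1 _ _ (adj_ends w); rewrite len_ends// => IHw.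
  have -> : forall z1 z2 p1 p2 : R, z1 + (z2 - z1) * p2 - (z1 + (z2 - z1) * p1) =
      (z2 - z1) * (p2 - p1) by move=> *; ring.
  by rewrite -(len_potential hG bc) normrM (gtr0_norm (len_gt0 hG bc)) ler_wpM2r// ltW// (len_gt0 hG bc).
rewrite (tfun_flat h.1) ?subrr; last by case/andP: st.
rewrite !mul0r !addr0 mul1r opprD addrACA subrr add0r -mulrBr !normrM.
have -> : `|sg (h.2 w) : R| = 1 by rewrite /sg normr_sign.
rewrite mul1r (gtr0_norm (wlen_gt0 hG w)) (ger0_norm r_ge0) mulrAC mulrC.
apply: ler_wpM2l; first exact/ltW/wlen_gt0.
apply: le_trans (r_le (exist _ (b, c) bc)); rewrite -[leRHS]mulr1; apply: ler_wpM2l => //.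
by case: (c == a); case: (b == a); rewrite ?subrr ?subr0 ?sub0r ?normrN ?normr0 ?normr1.
Qed.

(** Bumps and test terms carry the same signs, which square to 1, so the value does not depend on
    [h]. *)
Lemma test_tfun n (h : signs n) : test (tfun h) h = r * stopped_mass n.
Proof.
elim: n h => [|n IH] h /=; first by rewrite mulr0.
rewrite mulrDr; congr (_ + _); first exact: IH.
rewrite mulr_sumr; apply: eq_bigr => w _; rewrite /tterm.
have := tfun_in h w a; rewrite /= -/(mid w) => ->; rewrite slash_ext_up.
have [st|_] := boolP (stopped w); last by rewrite !(mul0r, mulr0).
rewrite (tfun_flat h.1); last by case/andP: st.
rewrite subrr mul0r addr0 eqxx mulr1 !mul1r.
have -> : forall s z z1 z2 z3 : R, s * (z1 * (z + s * (z2 * z3) - z)) = (s * s) * (z2 * (z1 * z3)).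
  by move=> *; ring.
by rewrite sgK mul1r.
Qed.

End Tests.

(** * The lower bound *)

Section LowerBound.
Variables (R : realType) (G : stgraph R).
Hypothesis hG : is_stgraph G.
Notation E := (edge G).
Notation esrc e := (val (e : E)).1.
Notation etgt e := (val (e : E)).2.
Notation Gn n := (slash_pow G n).
Variables (a : sV G) (th0 k r : R).
Hypotheses (a_neq_s : a != s_ G) (a_neq_t : a != t_ G).
Hypotheses (th0_gt0 : 0 < th0) (th0_le1 : th0 <= 1).
Hypothesis th0_le : forall e : E, th0 <= th G (esrc e) (etgt e).
Hypotheses (k_ge1 : 1 <= k) (k_var : forall f : sV G -> R, `|f a - f (s_ G)| <=
  k * \sum_(e : E) th G (esrc e) (etgt e) * `|f (etgt e) - f (esrc e)|).
Hypotheses (r_gt0 : 0 < r) (r_le : forall e : E, r <= len G (esrc e) (etgt e)).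

(** The number [4^-j], kept as a square to be compared with [q ^+ 2] through [2^-j <= q]. *)
Definition threshold (j : nat) : R := (2^-1 ^+ j) ^+ 2.

Lemma threshold_gt0 j : 0 < threshold j.
Proof. by rewrite !exprn_gt0// invr_gt0. Qed.

Lemma threshold_le1 j : threshold j <= 1.
Proof. by rewrite !exprn_ile1 ?exprn_ge0 ?invr_ge0// invf_le1// ler1n. Qed.

Lemma card_signs_gt0 n : 0 < #|signs G n|%:R :> R.
Proof.
rewrite ltr0n; elim: n => [|n IH]; first by rewrite card_unit.
rewrite card_prod muln_gt0 IH; apply/card_gt0P.
by exists [ffun=> true].
Qed.

Definition test_mean n (j : nat) (f : sV (Gn n) -> R) : R :=
  #|signs G n|%:R^-1 * \sum_(h : signs G n) `|test a (threshold j) f h|.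

Lemma test_mean_cut n (j : nat) (S : pred (sV (Gn n))) (q : R) :
  q = Num.sqrt (k / th0 * edge_variation (fun v => (S v)%:R)) ->
  test_mean j (fun v => (S v)%:R) <= q * (if 2^-1 ^+ j <= q then 2^-1 ^+ j else 0).
Proof.
set f := fun v => (S v)%:R; move=> qE.
have k0 : 0 <= k by exact: le_trans ler01 k_ge1.
have A0 : 0 <= edge_variation f.
  by apply: sumr_ge0 => w _; rewrite mulr_ge0// ltW// wth_gt0.
have Q0 : 0 <= k / th0 * edge_variation f by rewrite mulr_ge0// divr_ge0// ltW.
have q2 : q ^+ 2 = k / th0 * edge_variation f by rewrite qE sqr_sqrtr.
have q0 : 0 <= q by rewrite qE sqrtr_ge0.
have p0 : 0 < 2^-1 ^+ j :> R by rewrite exprn_gt0// invr_gt0.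
have c0 := card_signs_gt0 n.
have tau0 := threshold_gt0 j; have tau1 := threshold_le1 j.
have sqS := sq_test_cut hG a tau0 S.
have absv := abs_test_variation hG (threshold j) k_ge1 k_var f.
have absq : abs_test a (threshold j) f <= q ^+ 2.
  apply: le_trans absv _; rewrite q2; apply: ler_wpM2r => //.
  by rewrite ler_pdivlMr// ler_piMr.
rewrite /test_mean ler_pdivrMl//; case: ifPn => [pq|npq].
  apply: mean_abs_le; first by rewrite mulr_gt0// (lt_le_trans p0).
  rewrite test_second_moment; apply: ler_wpM2l; first exact: ltW.
  apply: le_trans sqS _; rewrite exprMn mulrC; apply: ler_wpM2r => //.
  exact: ltW.
(* Below the scale [q] the second moment sufficed. Here [q < 2^-j], so the total of the terms is
   less than [th0] times the threshold and must vanish. *)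
have S10 : abs_test a (threshold j) f = 0.
  have [//|h] := abs_test_cut hG a tau0 tau1 th0_gt0 th0_le1 th0_le S.
  exfalso; move/negP: npq; apply.
  have : threshold j <= q ^+ 2.
    rewrite q2 mulrAC ler_pdivlMr// mulrC.
    exact: le_trans h absv.
  by rewrite ler_pXn2r// ?nnegrE// ltW.
have : \sum_(h : signs G n) test a (threshold j) f h ^+ 2 = 0.
  apply/le_anti/andP; split; last by apply: sumr_ge0 => h _; rewrite sqr_ge0.
  rewrite test_second_moment; apply: mulr_ge0_le0; first exact: ltW.
  by apply: le_trans sqS _; rewrite -/f S10 mulr0.
move/eqP; rewrite psumr_eq0; last by move=> h _; rewrite sqr_ge0.
move=> /allP t0; rewrite !mulr0 big1// => h _.
have := t0 h; rewrite mem_index_enum => /(_ isT) /=.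
by rewrite sqrf_eq0 => /eqP ->; rewrite normr0.
Qed.

Lemma test_sobolev n (J : nat) (f : sV (Gn n) -> R) :
  \sum_(j < J) test_mean j f <= 2 * k / th0 * edge_variation f.
Proof.
apply: (@coarea _ _ _ (fun f => \sum_(j < J) test_mean j f)).
- move=> g1 g2; rewrite -big_split /=; apply: ler_sum => j _.
  rewrite /test_mean -mulrDr; apply: ler_wpM2l; first by rewrite invr_ge0.
  rewrite -big_split /=; apply: ler_sum => h _.
  have := @test_linear _ _ a (threshold j) n 1 g1 g2 h.
  rewrite (_ : (fun v => _) = fun v => g1 v + g2 v); last first.
    by apply/funext => v; rewrite mul1r.
  by move=> ->; rewrite mul1r ler_normD.
- move=> c g c0; rewrite mulr_sumr; apply: ler_sum => j _.
  rewrite /test_mean mulrCA; apply: ler_wpM2l; first by rewrite invr_ge0.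
  rewrite mulr_sumr; apply: ler_sum => h _.
  have := @test_linear _ _ a (threshold j) n c g (fun=> 0) h.
  rewrite test_const addr0 (_ : (fun v => _) = fun v => c * g v); last first.
    by apply/funext => v; rewrite addr0.
  by move=> ->; rewrite normrM (ger0_norm c0).
- move=> c; rewrite big1// => j _; rewrite /test_mean big1 ?mulr0// => h _.
  by rewrite test_const normr0.
move=> S; set q := Num.sqrt (k / th0 * edge_variation (fun v => (S v)%:R)).
have A0 : 0 <= edge_variation (fun v => (S v)%:R).
  by apply: sumr_ge0 => w _; rewrite mulr_ge0// ltW// wth_gt0.
have q0 : 0 <= q by exact: sqrtr_ge0.
have q2 : q ^+ 2 = k / th0 * edge_variation (fun v => (S v)%:R).
  by rewrite sqr_sqrtr// mulr_ge0// divr_ge0 ?(ltW th0_gt0)// (le_trans ler01).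
(* The geometric sum over [j] contributes [2 * q], and [q ^+ 2] is [k / th0] times the variation of
   the cut. *)
apply: (@le_trans _ _ (q * (2 * q))); last first.
  by rewrite mulrCA -expr2 q2 !mulrA.
apply: le_trans (ler_sum _ (fun (j : 'I_J) _ => test_mean_cut j (erefl q))) _.
rewrite -mulr_sumr; apply: ler_wpM2l => //.
apply: le_trans (dyadic_tail_sum q J) _.
by rewrite ge_max lexx andbT mulr_ge0.
Qed.

Variables (n J : nat) (D : R).
Variables (dT : measure_display) (T : measurableType dT) (mu : {measure set T -> \bar R}).
Variable F : {ffun sV (Gn n.+1) -> R} -> T -> R.
Hypothesis D_ge0 : 0 <= D.
Hypothesis F_int : forall f, mass0 R _ f -> mu.-integrable setT (EFin \o F f).
Hypothesis F_dist : forall f g, mass0 R _ f -> mass0 R _ g ->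
  ((tcnorm _ (dist (Gn n.+1)) (f - g))%:E <= \int[mu]_x (`|F f x - F g x|)%:E)%E /\
  (\int[mu]_x (`|F f x - F g x|)%:E <= (D * tcnorm _ (dist (Gn n.+1)) (f - g))%:E)%E.
Hypothesis stopped_half : forall j, (j < J)%N -> 1 / 2 <= stopped_mass G (threshold j) n.+1.

Lemma distortion_bound : J%:R <= 4 * k / (th0 * r) * D.
Proof.
have [N HN] := choice (fun j => test_integral hG a (threshold j)).
pose M j : R := (N j)%:R ^+ n.+1.
have M0 j : 0 < M j by rewrite exprn_gt0// ltr0n; exact: (HN j).1.
pose K : finType := ('I_J * signs G n.+1)%type.
have [lp Hlp] := choice (fun x : K => (HN x.1).2 n.+1 x.2).
have [lm Hlm] := choice Hlp.
have c0 := card_signs_gt0 n.+1.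
have tI (x : K) f : \sum_(p <- lp x) f p - \sum_(p <- lm x) f p =
    M x.1 * test a (threshold x.1) f x.2 by rewrite (Hlm x).2.
(* The weight averages over the signs and undoes the factor [M] that cleared denominators. *)
pose al (x : K) : R := #|signs G n.+1|%:R^-1 * (M x.1)^-1.
have len0 x y : adj (Gn n.+1) x y -> 0 <= len (Gn n.+1) x y.
  by move=> xy; rewrite ltW// len_slash_pow_gt0.
have bound := @L1_TC_bound R _ (dist (Gn n.+1)) (s_ _) D dT T mu F K (word G n.+1) al lp lm
  (fun x => tfun a (threshold x.1) r x.2) (fun x => M x.1 * (r * stopped_mass G (threshold x.1) n.+1))
  (fun w => 2 * k / th0 * wth w) (fun w => (ends w).1) (fun w => (ends w).2).
have k0 : 0 <= k by exact: le_trans ler01 k_ge1.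
have C0 : 0 <= 2 * k / th0 by rewrite divr_ge0 ?mulr_ge0// ltW.
have : J%:R * (r * (1 / 2)) <= 2 * k / th0 * D.
  apply: (@le_trans _ _ (\sum_(x : K) al x * (M x.1 * (r * stopped_mass G (threshold x.1) n.+1)))).
    rewrite (eq_bigr (fun x : K => #|signs G n.+1|%:R^-1 *
        (r * stopped_mass G (threshold x.1) n.+1))); last first.
      by move=> x _; rewrite /al -!mulrA; congr (_ * _); rewrite mulKf// gt_eqF.
    rewrite -(pair_big xpredT xpredT (fun (j : 'I_J) (h : signs G n.+1) => #|signs G n.+1|%:R^-1 *
        (r * stopped_mass G (threshold j) n.+1))) /=.
    rewrite -[J in J%:R](card_ord J) mulr_natl -sumr_const; apply: ler_sum => j _.
    have sE (Y : R) : \sum_(h : signs G n.+1) #|signs G n.+1|%:R^-1 * Y = Y.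
      transitivity ((#|signs G n.+1|%:R^-1 * Y) *+ #|signs G n.+1|); first by rewrite sumr_const.
      by rewrite -[LHS]mulr_natl mulVKf// gt_eqF.
    rewrite sE.
    by apply: ler_wpM2l; [exact: ltW|exact: stopped_half].
  apply: le_trans (bound _ _ _ _ _ _ _ _ _ _) _.
  - by move=> x y; exact: dist_ge0.
  - exact: D_ge0.
  - exact: F_int.
  - exact: F_dist.
  - by move=> x; exact: (Hlm x).1.
  - move=> x u v.
    have := @lipschitz_dist R _ (fun z => - tfun a (threshold x.1) r x.2 z) _ u v
      (slash_pow_connected hG u v).
    rewrite opprK addrC; apply => y z yz.
    by rewrite opprK addrC distrC; apply: tfun_lipschitz => //; exact: ltW.
  - by move=> x; rewrite tI test_tfun.
  - by move=> x; rewrite mulr_ge0// invr_ge0// ltW.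
  - by move=> w; rewrite mulr_ge0// ltW// wth_gt0.
  - move=> f.
    rewrite (eq_bigr (fun x : K => #|signs G n.+1|%:R^-1 * `|test a (threshold x.1) f x.2|)); last first.
      move=> x _; rewrite tI normrM (gtr0_norm (M0 _)) /al -mulrA; congr (_ * _).
      by rewrite mulKf// gt_eqF.
    rewrite -(pair_big xpredT xpredT (fun (j : 'I_J) (h : signs G n.+1) => #|signs G n.+1|%:R^-1 *
       `|test a (threshold j) f h|)) /=.
    under eq_bigr do rewrite -mulr_sumr.
    apply: le_trans (test_sobolev J f) _; rewrite /edge_variation mulr_sumr; apply: ler_sum => w _.
    by rewrite mulrA distrC.
  (* Endpoint distances are at most edge lengths, and the weights thickness times length sum to
     1. *)
  apply: le_trans (_ : \sum_(w : word G n.+1) 2 * k / th0 * D * (wth w * wlen w) <= _); last first.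
    by rewrite -mulr_sumr sum_wth_wlen// mulr1.
  apply: ler_sum => w _; rewrite -[leLHS]mulrA -[leRHS]mulrA; apply: ler_wpM2l => //.
  rewrite mulrCA; apply: ler_wpM2l => //; apply: ler_wpM2l; first by rewrite ltW// wth_gt0.
  by rewrite -len_ends//; apply: dist_adj_le => //; exact: adj_ends.
move=> h; have h2 : J%:R * r <= 4 * k / th0 * D by lra.
rewrite invfM mulrA mulrAC ler_pdivlMr//.
Qed.

End LowerBound.

(** * Choice of constants and conclusion *)

Lemma pos_family_lower_bound (R : realType) (I : finType) (f : I -> R) :
  (forall i, 0 < f i) -> exists m : R, [/\ 0 < m, m <= 1 & forall i, m <= f i].
Proof.
move=> f0; suff [m [m0 m1 H]] : exists m : R, [/\ 0 < m, m <= 1 & forall i, i \in enum I -> m <= f i].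
  by exists m; split=> // i; apply: H; rewrite mem_enum.
elim: (enum I) => [|i s [m [m0 m1 H]]]; first by exists 1.
exists (Num.min m (f i)); split; first by rewrite lt_min m0 f0.
  by rewrite ge_min m1.
by move=> j; rewrite inE => /orP[/eqP->|/H]; rewrite ge_min ?lexx ?orbT// => ->.
Qed.

Lemma pow_small (R : realType) (x e : R) : 0 <= x -> x < 1 -> 0 < e ->
  exists p : nat, (0 < p)%N /\ x ^+ p <= e.
Proof.
move=> x0 x1 e0; have xx : `|x| < 1 by rewrite ger0_norm.
have [N _ HN] := cvgr_lt _ (cvg_expr xx) _ e0.
by exists N.+1; split=> //; apply/ltW/HN => /=.
Qed.

Unset Implicit Arguments.

Theorem theorem1p2 (R : realType) (G : stgraph R) :
  is_stgraph G -> ~ is_stpath G -> (3 <= #|sV G|)%N ->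
  exists C : R, 0 < C /\
    forall n : nat,
      ((C^-1 * ln (#|sV (slash_pow G n)|%:R))%:E <= c1_TC _ (dist (slash_pow G n)))%E.
Proof.
move=> hG nst V3.
have [a /andP[a_s a_t]] : exists a : sV G, (a != s_ G) && (a != t_ G).
  apply/existsP; apply: contraTT V3; rewrite negb_exists => /forallP H.
  rewrite -ltnNge ltnS; apply: leq_trans (card_size [:: s_ G; t_ G]).
  apply: subset_leq_card; apply/fintype.subsetP => x _; rewrite !inE.
  by have := H x; rewrite negb_and !negbK.
have th0P (e : edge G) : 0 < th G (val e).1 (val e).2.
  by have /andP[] := th_gt0_le1 hG (valP e).
have len0P (e : edge G) : 0 < len G (val e).1 (val e).2 by exact: (len_gt0 hG (valP e)).
have [th0 [th0_gt0 th0_le1 th0_le]] := pos_family_lower_bound th0P.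
have [r [r_gt0 _ r_le]] := pos_family_lower_bound len0P.
have [k' [k'0 Hk']] := variation_connected hG a.
pose k := k' + 1; have k1 : 1 <= k by rewrite lerDr ltW.
have Hk (f : sV G -> R) : `|f a - f (s_ G)| <= k * \sum_(e : edge G)
    th G (val e).1 (val e).2 * `|f (val e).2 - f (val e).1|.
  apply: le_trans (Hk' f) _; apply: ler_wpM2r; last by rewrite lerDl.
  by apply: sumr_ge0 => e _; rewrite mulr_ge0// ltW.
(* The expected thickness of a random letter; it is below 1 because a thin edge is chosen with
   positive probability. *)
pose lam := \sum_(e : edge G) th G (val e).1 (val e).2 ^+ 2 * len G (val e).1 (val e).2.
have lam0 : 0 <= lam by apply: sumr_ge0 => e _; rewrite mulr_ge0 ?sqr_ge0// ltW.
have lam1 : lam < 1.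
  have [e0 He0] := thin_edge hG nst.
  rewrite -(sum_th_len hG) /lam (bigD1 e0)//= [ltRHS](bigD1 e0)//=; apply: ltr_leD.
    rewrite ltr_pM2r; last exact: len0P.
    by rewrite expr2 gtr_pMr; [exact: He0|exact: th0P].
  apply: ler_sum => e _; apply: ler_wpM2r; first exact/ltW/len0P.
  by rewrite expr2 ger_pMr; [exact: th_le1|exact: th0P].
(* The value 1/8 is one half times one quarter: after [p * J] letters the expected thickness is at
   most [2^-J * 4^-J], so Markov's inequality at threshold [4^-j] with [j < J] loses at most 1/2. *)
have [p [p0 Hp]] : exists p : nat, (0 < p)%N /\ lam ^+ p <= 8^-1.
  by apply: pow_small; rewrite ?invr_gt0.
have [K [K1 HK]] := card_slash_pow G.
have lnK : 0 < ln (K%:R : R) by rewrite ln_gt0// ltr1n.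
pose X := 4 * k / (th0 * r).
have X0 : 0 <= X by rewrite divr_ge0 ?mulr_ge0 ?(le_trans ler01 k1) ?(ltW th0_gt0) ?(ltW r_gt0).
have p0' : 0 < p%:R :> R by rewrite ltr0n.
(* The number of vertices is at most [K ^ n.+1]. The term [p * X] pays for the scales, [p] for the
   remainder of the division by [p], and 2 for the shifts of the exponent, including the case
   [n = 0]; all are multiplied by [D >= 1]. *)
pose C := ln (K%:R : R) * (p%:R * X + p%:R + 2).
have C0 : 0 < C by rewrite mulr_gt0// addr_gt0// ltr_wpDl// mulr_ge0// ltW.
exists C; split=> // n; apply: le_ereal_inf_tmp => _ [D [D1 [dT [T [mu [F [Fi Fd]]]]]] <-].
rewrite lee_fin ler_pdivrMl//.
have D0 : 0 <= D by rewrite (le_trans ler01).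
have lnV : ln (#|sV (slash_pow G n)|%:R : R) <= n.+1%:R * ln (K%:R : R).
  have V0 : (0 < #|sV (slash_pow G n)|)%N by apply/card_gt0P; exists (s_ _).
  have K0 : (0 < K)%N by exact: ltnW.
  rewrite mulr_natl -lnXn ?ltr0n// ler_ln ?posrE ?exprn_gt0 ?ltr0n//.
  by rewrite -natrX ler_nat.
apply: le_trans lnV _; rewrite /C -mulrA mulrC; apply: ler_wpM2l; first exact: ltW.
have pX0 : 0 <= p%:R * X * D by exact: mulr_ge0 (mulr_ge0 (ltW p0') X0) D0.
have pD0 : p%:R <= p%:R * D by rewrite (ler_peMr (ltW p0') D1).
case: n F Fi Fd => [|n] F Fi Fd; first by lra.
pose J := (n %/ p)%N.
have JX : J%:R <= X * D.
  apply: (@distortion_bound R G hG a th0 k r a_s a_t th0_gt0 th0_le1 th0_le k1 Hk r_gt0 r_le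
    n J D dT T mu F D0 Fi Fd) => j jJ.
  apply: le_trans (stopped_mass_ge hG (threshold_gt0 R j) n); rewrite -/lam.
  suff : lam ^+ n / threshold R j <= 1 / 2 by lra.
  rewrite ler_pdivrMr ?threshold_gt0// /threshold.
  have h1 : lam ^+ n <= 8^-1 ^+ J.
    apply: (@le_trans _ _ ((lam ^+ p) ^+ J)).
      by rewrite -exprM; apply: ler_wiXn2l => //; [exact: ltW|rewrite mulnC leq_trunc_div].
    by apply: lerXn2r => //; rewrite ?nnegrE ?exprn_ge0// invr_ge0.
  apply: le_trans h1 _.
  have -> : 8^-1 = 2^-1 * 2^-1 ^+ 2 :> R by field.
  rewrite exprMn -!exprM div1r; apply: ler_pM; rewrite ?exprn_ge0 ?invr_ge0//.
    rewrite -[leRHS]expr1; apply: ler_wiXn2l; rewrite ?invr_ge0 ?invf_le1 ?ler1n//.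
    exact: leq_ltn_trans jJ.
  apply: ler_wiXn2l; rewrite ?invr_ge0 ?invf_le1 ?ler1n//.
  by rewrite mulnC leq_mul2l /= ltnW.
(* The remainder of [n] modulo [p] is below [p], so [n.+1] is at most [p * J + p]. *)
have nJ : n.+1%:R <= p%:R * J%:R + p%:R :> R.
  by rewrite -natrM -natrD ler_nat mulnC -mulSnr {1}(divn_eq n p) mulSnr -addnS leq_add2l ltn_pmod.
have := ler_wpM2l (ltW p0') JX.
rewrite -[n.+2%:R]natr1; lra.
Qed.
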